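(* Let $0<c<1$. Then for $n$ sufficiently large, \[ ex_3(n;\mathcal{L}_{n,cn}^{(3)})=\max\left\{\binom{cn}{3},\ \binom{n}{3}-\binom{n-\frac{cn}{3}}{3}\right\}+o(n^3). \]
   Context: A $3$-graph is a hypergraph all of whose edges have exactly $3$ vertices. A tight path is a $3$-graph whose vertices can be ordered $v_1,\dots,v_m$ so that its edges are exactly $\{v_i,v_{i+1},v_{i+2}\}$ for $i=1,\dots,m-2$. A tight linear forest is a $3$-graph each of whose connected components is a tight path or an isolated vertex. $\mathcal{L}_{n,k}^{(3)}$ is the family of all tight linear forests on $n$ vertices with $k$ edges. $ex_3(n;\mathcal{F})$ is the maximum number of edges in a $3$-graph on $n$ vertices containing no subgraph isomorphic to a member of $\mathcal{F}$. Quantities such as $cn$ and $cn/3$ are treated as integers (rounded); $o(n^3)$ is as $n\to\infty$ with $c$ fixed. *)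

(* Defs.v *)
From mathcomp Require Import all_boot.

Set Implicit Arguments.
Unset Strict Implicit.
Unset Printing Implicit Defensive.

(* Hypergraphs on a finite vertex type T are given by their edge sets
   E : {set {set T}}; every element of T is a vertex. *)
Section Hypergraphs.
Variable T : finType.
Implicit Types (E : {set {set T}}) (C : {set T}).

Definition graph3 E : bool := [forall e in E, #|e| == 3].

Definition hadj E : rel T := fun x y => [exists e in E, (x \in e) && (y \in e)].

Definition component E (x : T) : {set T} := [set y | connect (hadj E) x y].

Definition induced_edges E C : {set {set T}} := [set e in E | e \subset C].

(* For s = v_1 ... v_m, these are the sets {v_i, v_(i+1), v_(i+2)},
   1 <= i <= m - 2 (none if m < 3). *)
Definition tight_edges (s : seq T) : {set {set T}} :=
  [set [set v in take 3 (drop i s)] | i : 'I_(size s - 2)].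

Definition tight_path C E : bool :=
  [exists s : #|C|.-tuple T,
     [&& uniq s, [set v in s] == C & E == tight_edges s]].

Definition isolated_vertex C E : bool := (#|C| == 1) && (E == set0).

Definition tight_linear_forest E : bool :=
  graph3 E &&
  [forall x, let C := component E x in
     tight_path C (induced_edges E C) || isolated_vertex C (induced_edges E C)].

End Hypergraphs.

(* E, as a hypergraph on T, has a subgraph isomorphic to F. *)
Definition contains_copy (S T : finType)
    (F : {set {set S}}) (E : {set {set T}}) : bool :=
  [exists f : {ffun S -> T},
     injectiveb f && [forall e in F, f @: e \in E]].

(* Members of the family are considered up to isomorphism, hence on 'I_n. *)
Definition TLF (n k : nat) : {set {set {set 'I_n}}} :=
  [set F | tight_linear_forest F & #|F| == k].

(* The maximum of an empty set of values is 0 here: this occurs only when the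
   edgeless hypergraph itself contains a member of the family. *)
Definition ex3 (n m : nat) (Fam : {set {set {set 'I_m}}}) : nat :=
  \max_(E : {set {set 'I_n}} |
        graph3 E && [forall F in Fam, ~~ contains_copy F E]) #|E|.

(* Main.v *)
(** Upper bound.  Sample a bounded number of vertices of a 3-graph [H] with
    more than the claimed number of edges.  By linear programming duality the
    sample has a large fractional matching: otherwise there are vertex weights of
    small total such that every edge has weight at least 1, and by complementary
    slackness the number of triples of weight at least 1 can be counted through
    triples of triples of total weight 1, where it reduces to an inequality
    between finitely many numbers (a fractional Erdős matching theorem for
    3-graphs).  The same sample occurs as a complete blow-up, by pigeonhole and
    the supersaturation argument of Kővári-Sós-Turán and Erdős; the weights of
    the fractional matching split this blow-up into complete tripartite 3-graphs,
    each spanned by a tight path.  The blow-up can be chosen with vertex degrees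
    that are not larger than average, so that its deletion leaves the edge density
    almost unchanged and the process can be repeated until few vertices remain.

    Lower bound.  A vertex of a tight linear forest lies in at most 3 edges, so
    that [k] edges span at least [k] vertices and are not met by fewer than
    [k / 3] vertices. *)

Require Import Defs.
From mathcomp Require Import all_boot all_order all_algebra.
From mathcomp Require Import ring lra zify.
From mathcomp Require Import boolp.
Set Implicit Arguments.
Unset Strict Implicit.
Unset Printing Implicit Defensive.
Import Order.TTheory GRing.Theory Num.Theory.
Local Open Scope ring_scope.

(** * Linear programming duality *)

(** A tight path winding cyclically through three classes of size [l] has [3 * l] vertices and
    [3 * l - 2] edges: up to its ends, a forest has as many edges as it covers vertices. Hence
    [c * n] edges correspond to a fractional matching of mass [c / 3] per vertex, and the clique and
    the star of the statement are the two extremal hosts of that fractional problem. The two edges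
    lost per path are negligible only because a blow-up carries boundedly many paths while its
    classes can be taken as large as desired.

    Supersaturation yields blow-ups of bounded size, so linearly many must be removed in turn, and
    an error per removal that is not of order [1 / n] would destroy the density. This is why samples
    are also selected by their degree sum: for nearly average degrees, the loss of triples agrees to
    first order with the loss in the cube of the number of vertices.

    The fractional problem is tractable because complementary slackness gives every edge in the
    support of the matching weight exactly 1, which leaves nine numbers and one parameter. *)

Lemma farkas (R : realFieldType) (I J : finType) (s : seq J) :
  uniq s -> forall (A : J -> I -> R) (g : I -> R),
  (forall x : I -> R, (forall j, j \in s -> \sum_i A j i * x i <= 0) ->
     \sum_i g i * x i <= 0) ->
  exists l : J -> R, (forall j, 0 <= l j) /\
     forall i, g i = \sum_(j <- s) l j * A j i.
Proof.
elim: s => [_ A g gle0|j0 s IH /= /andP[j0s us] A g gle0].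
  exists (fun=> 0); split=> // i; rewrite big_nil.
  have := gle0 g (fun j => ltac:(by rewrite in_nil)).
  move=> le0; have /eqP : \sum_i g i * g i = 0.
    by apply/eqP; rewrite eq_le le0 sumr_ge0 // => k _; rewrite -expr2 sqr_ge0.
  rewrite psumr_eq0 => [|k _]; last by rewrite -expr2 sqr_ge0.
  by move=> /allP/(_ i (mem_index_enum i))/=; rewrite mulf_eq0 orbb => /eqP.
have big_s (l : J -> R) y i : \sum_(j <- s) (if j == j0 then y else l j) * A j i
    = \sum_(j <- s) l j * A j i.
  rewrite !big_seq; apply: eq_bigr => j js.
  by case: eqP => // ejj; rewrite -ejj js in j0s.
case: (EM (forall x : I -> R,
    (forall j, j \in s -> \sum_i A j i * x i <= 0) -> \sum_i g i * x i <= 0)).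
  move=> /(IH us)[l [l_ge0 gE]].
  exists (fun j => if j == j0 then 0 else l j); split=> [j|i]; first by case: ifP.
  by rewrite big_cons eqxx mul0r add0r big_s.
move=> /existsNP[z /not_implyP[zle0 /negP]]; rewrite -ltNge => gz_gt0.
pose dot (a x : I -> R) := \sum_i a i * x i.
have dotB (a b x : I -> R) y : dot (fun i => a i - y * b i) x = dot a x - y * dot b x.
  by rewrite /dot mulr_sumr -sumrB; apply: eq_bigr => i _; ring.
have dotBr (a b x : I -> R) y : dot a (fun i => x i - y * b i) = dot a x - y * dot a b.
  by rewrite /dot mulr_sumr -sumrB; apply: eq_bigr => i _; ring.
have A0z_gt0 : 0 < dot (A j0) z.
  rewrite ltNge; apply/negP => A0z; have := gle0 z; rewrite leNgt gz_gt0 => H.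
  by apply/notF/H => j; rewrite inE => /orP[/eqP->//|]; apply: zle0.
set D := dot (A j0) z in A0z_gt0.
(* The new functionals are the old ones composed with the projection along [z] onto the kernel of
   [A j0]. After this projection the constraint [j0] holds with equality, so only the constraints in
   [s] remain. *)
have [x|l [l_ge0 gE]] := IH us (fun j i => A j i - dot (A j) z / D * A j0 i)
    (fun i => g i - dot g z / D * A j0 i).
  move=> xle0; have := gle0 (fun i => x i - dot (A j0) x / D * z i).
  rewrite -!/(dot _ _) dotB => H; have : dot g (fun i => x i - dot (A j0) x / D * z i) <= 0.
    apply: H => j; rewrite -/(dot _ _) dotBr inE => /orP[/eqP->|js].
      by rewrite -/D divfK ?subrr // gt_eqF.
    have := xle0 j js; rewrite -/(dot _ _) dotB.
    by congr (_ <= _); rewrite mulrAC [in RHS]mulrAC [dot _ x * _]mulrC.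
  by rewrite dotBr; congr (_ <= _); rewrite mulrAC [in RHS]mulrAC [dot _ x * _]mulrC.
pose y := dot g z / D - \sum_(j <- s) l j * (dot (A j) z / D).
exists (fun j => if j == j0 then y else l j); split=> [j|i].
  case: ifP => // _; rewrite subr_ge0 (@le_trans _ _ 0) //.
    rewrite big_seq; apply: sumr_le0 => k ks; rewrite mulr_ge0_le0 //.
    by rewrite ler_pdivrMr // mul0r; apply: zle0.
  by rewrite divr_ge0 // ltW.
rewrite big_cons eqxx big_s /y mulrBl [X in _ - X + _]mulr_suml.
rewrite -addrA addrC -sumrN -big_split/=.
rewrite -[LHS](subrK (dot g z / D * A j0 i)) gE; congr (_ + _).
by apply: eq_bigr => j _; ring.
Qed.

(* Homogenising the primal and dual constraints together with
   [\sum_i w i <= \sum_j p j], a Farkas certificate of infeasibility would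
   violate weak duality. *)
Lemma packing_covering_duality (R : realFieldType) (I J : finType) (M : J -> I -> R) :
  (forall j i, 0 <= M j i) -> (forall j, exists i, 0 < M j i) ->
  exists (w : I -> R) (p : J -> R),
   [/\ forall i, 0 <= w i, forall j, 0 <= p j,
       forall i, \sum_j p j * M j i <= 1,
       forall j, 1 <= \sum_i M j i * w i &
       \sum_i w i <= \sum_j p j].
Proof.
move=> M_ge0 M_gt0.
(* The unknowns are [w], [p] and the homogenising variable [z]. Rows [(true, k)] of [A] are the sign
   conditions; rows [(false, _)] are the packing constraints, the covering constraints and the
   comparison of the two totals. *)
pose K := (I + (J + unit))%type.
pose W (x : K -> R) i := x (inl i); pose P (x : K -> R) j := x (inr (inl j)).
pose z (x : K -> R) := x (inr (inr tt)).
pose g (k : K) : R := if k is inr (inr _) then 1 else 0.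
pose d (b : bool) : R := b%:R.
pose A (c : bool * K) (k : K) : R := match c, k with
  | (true, c), k => - d (c == k)
  | (false, inl i), inl i' => 0
  | (false, inl i), inr (inl j) => M j i
  | (false, inl i), inr (inr _) => -1
  | (false, inr (inl j)), inl i => - M j i
  | (false, inr (inl j)), inr (inl _) => 0
  | (false, inr (inl j)), inr (inr _) => 1
  | (false, inr (inr _)), inl i => 1
  | (false, inr (inr _)), inr (inl _) => -1
  | (false, inr (inr _)), inr (inr _) => 0 end.
have bigK (F : K -> R) : \sum_k F k =
    \sum_i F (inl i) + (\sum_j F (inr (inl j)) + F (inr (inr tt))).
  rewrite big_sumType big_sumType/=; congr (_ + (_ + _)).
  by rewrite (big_pred1 tt)// => -[].
have bigd (x : K -> R) k : \sum_k' - d (k == k') * x k' = - x k.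
  rewrite (bigD1 k)//= eqxx mulN1r big1 ?addr0// => k' k'k.
  by rewrite eq_sym (negPf k'k) oppr0 mul0r.
case: (EM (exists x, (forall c, \sum_k A c k * x k <= 0) /\ 0 < z x)).
  move=> [x [xle0 z_gt0]].
  have x_ge0 k : 0 <= x k by rewrite -oppr_le0 -bigd; apply: (xle0 (true, k)).
  exists (fun i => W x i / z x), (fun j => P x j / z x); split.
  - by move=> i; apply: divr_ge0 (x_ge0 _) (ltW z_gt0).
  - by move=> j; apply: divr_ge0 (x_ge0 _) (ltW z_gt0).
  - move=> i; have := xle0 (false, inl i); rewrite bigK/= big1 => [|? _]; last by rewrite mul0r.
    rewrite add0r mulN1r subr_le0 -/(z x) => le; under eq_bigr do rewrite mulrAC.
    rewrite -mulr_suml ler_pdivrMr// mul1r; apply: le_trans le.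
    by apply: ler_sum => j _; rewrite mulrC.
  - move=> j; have := xle0 (false, inr (inl j)); rewrite bigK/=.
    rewrite [X in _ + (X + _)]big1 => [|? _]; last by rewrite mul0r.
    under eq_bigr do rewrite mulNr.
    rewrite sumrN add0r mul1r addrC subr_le0 -/(z x) => le.
    under eq_bigr do rewrite mulrA.
    by rewrite -mulr_suml ler_pdivlMr// mul1r.
  - have := xle0 (false, inr (inr tt)); rewrite bigK/= mul0r addr0.
    rewrite -!mulr_suml ler_pM2r ?invr_gt0// => le; rewrite -subr_le0.
    move: le; congr (_ <= _); rewrite -sumrN; congr (_ + _).
      by apply: eq_bigr => i _; rewrite mul1r.
    by apply: eq_bigr => i _; rewrite mulN1r.
move=> nex.
have [|l [l_ge0 gE]] := @farkas R K _ (index_enum (bool * K)%type) (index_enum_uniq _) A g.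
  move=> x xle0; have xle c := xle0 c (mem_index_enum c).
  rewrite leNgt; apply/negP => gt0; apply: nex; exists x; split=> //.
  move: gt0; rewrite bigK/= !big1 ?add0r ?mul1r// => *; exact: mul0r.
have lbig k : g k = \sum_c l (false, c) * A (false, c) k - l (true, k).
  rewrite gE (bigID (fun c => c.1))/= addrC.
  rewrite (reindex (fun c : K => (false, c)))/=; last first.
    by exists snd => [[]|[[]]].
  congr (_ + _); rewrite (reindex (fun c : K => (true, c)))/=; last first.
    by exists snd => [[]|[[]]].
  under eq_bigr do rewrite mulrC eq_sym.
  exact: bigd.
(* In the certificate the roles are exchanged: [p] is a covering and [q] a packing, both at level
   [r], with the total of [q] larger by 1. Level 0 forces [q = 0], since every row of [M] has a
   positive entry; a positive level contradicts weak duality. *)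
pose r := l (false, inr (inr tt)).
pose p i := l (false, inl i); pose q j := l (false, inr (inl j)).
have pr j : r <= \sum_i p i * M j i.
  have := lbig (inr (inl j)); rewrite bigK/= => /esym/eqP.
  rewrite [X in _ + (X + _)]big1 => [|? _]; last by rewrite mulr0.
  rewrite add0r mulrN1 -/r subr_eq0 => /eqP E; rewrite -subr_ge0 E; exact: l_ge0.
have qr i : \sum_j q j * M j i <= r.
  have := lbig (inl i); rewrite bigK/= => /esym/eqP.
  rewrite big1 => [|? _]; last by rewrite mulr0.
  rewrite add0r mulr1 -/r subr_eq0 addrC => /eqP E.
  have -> : \sum_j q j * M j i = - \sum_j (l (false, inr (inl j)) * - M j i).
    by rewrite -sumrN; apply: eq_bigr => j _; rewrite mulrN opprK.
  by rewrite -subr_ge0 opprK E; apply: l_ge0.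
have pq : \sum_i p i + 1 <= \sum_j q j.
  have := lbig (inr (inr tt)); rewrite bigK/= mulr0 addr0 => E.
  have -> : \sum_i p i = - \sum_i l (false, inl i) * -1.
    by rewrite -sumrN; apply: eq_bigr => i _; rewrite mulrN1 opprK.
  have -> : \sum_j q j = \sum_j l (false, inr (inl j)) * 1.
    by apply: eq_bigr => i _; rewrite mulr1.
  have := l_ge0 (true, inr (inr tt)); move: E.
  by move: (\sum_i _) (\sum_j _) (l _) => a b e; lra.
have r_ge0 : 0 <= r by apply: l_ge0.
exfalso; move: r_ge0; rewrite le_eqVlt => /orP[/eqP r0|r_gt0].
  have q0 j : q j = 0.
    have [i Mi] := M_gt0 j; have := qr i; rewrite -r0 => le.
    have : q j * M j i <= 0.
      apply: le_trans le; rewrite (bigD1 j)//= lerDl sumr_ge0// => k _.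
      by rewrite mulr_ge0//; apply: l_ge0.
    rewrite pmulr_lle0// => qle; apply/eqP; rewrite eq_le qle; exact: l_ge0.
  move: pq; rewrite [X in _ <= X]big1// leNgt => /negP; apply.
  by rewrite ltr_wpDl// sumr_ge0// => i _; apply: l_ge0.
have : r * \sum_j q j <= r * \sum_i p i.
  rewrite !mulr_sumr (@le_trans _ _ (\sum_j \sum_i q j * (p i * M j i)))//.
    apply: ler_sum => j _; rewrite -mulr_sumr mulrC ler_wpM2l//; exact: l_ge0.
  rewrite exchange_big/=; apply: ler_sum => i _.
  under eq_bigr do rewrite mulrCA.
  by rewrite -mulr_sumr mulrC ler_wpM2r//; apply: l_ge0.
rewrite ler_pM2l// => le; have := le_trans pq le.
by rewrite gerDl ler10.
Qed.

(** * Triples of total weight 1 *)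

Section Local.
Variable R : realFieldType.
Implicit Types (s u : R) (e : seq R).

Definition heavy s : R := (1 <= s)%R%:R.

Definition heavy1 e : R := \sum_(x <- e) heavy x.
Definition heavy2 e f : R := \sum_(x <- e) \sum_(y <- f) heavy (x + y).
Definition heavy3 e f g : R :=
  \sum_(x <- e) \sum_(y <- f) \sum_(z <- g) heavy (x + y + z).

Lemma heavy_ge0 s : 0 <= heavy s. Proof. exact: ler0n. Qed.
Lemma heavy_le1 s : heavy s <= 1.
Proof. by rewrite /heavy; case: (1 <= s)%R; rewrite ?ler01 ?lexx. Qed.

Lemma heavy_eq0 s : s < 1 -> heavy s = 0.
Proof. by rewrite /heavy leNgt => ->. Qed.

Definition distr3 a b c := [/\ b <= a, c <= b, 0 <= c & a + b + c = 1 :> R].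

Ltac expand_heavy :=
  rewrite ?/heavy3 ?/heavy2 ?/heavy1 ?big_cons ?big_nil ?addr0.

Ltac count_heavy :=
  rewrite ?add0r ?addr0; eapply le_trans;
  [repeat apply: lerD; exact: heavy_le1 | lra].

Ltac drop_heavy s := rewrite (@heavy_eq0 s); last (by lra).

(** [a + c'], [b + b'] and [c + a'] add up to 2, so they are not all heavy; [b + c'], [c + b'] and
    [c + c'] are always light. *)
Lemma heavy2_le5 a b c a' b' c' : distr3 a b c -> distr3 a' b' c' ->
  heavy2 [:: a; b; c] [:: a'; b'; c'] <= 5.
Proof.
move=> [ab bc c0 s] [ab' bc' c0' s']; expand_heavy.
drop_heavy (b + c'); drop_heavy (c + b'); drop_heavy (c + c').
have [H|H] := ltP (a + c') 1; first by drop_heavy (a + c'); count_heavy.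
have [H'|H'] := ltP (c + a') 1; first by drop_heavy (c + a'); count_heavy.
by drop_heavy (b + b'); count_heavy.
Qed.

(** If two of [a + c'], [b + b'], [c + a'] were heavy, the third would vanish, so that either
    [a = 1] or a largest entry is 0. *)
Lemma heavy2_le4 a b c a' b' c' : distr3 a b c -> distr3 a' b' c' -> a < 1 ->
  heavy2 [:: a; b; c] [:: a'; b'; c'] <= 4.
Proof.
move=> [ab bc c0 s] [ab' bc' c0' s'] a1; expand_heavy.
drop_heavy (b + c'); drop_heavy (c + b'); drop_heavy (c + c').
have [H|H] := ltP (a + c') 1; have [H'|H'] := ltP (c + a') 1.
- by drop_heavy (a + c'); drop_heavy (c + a'); count_heavy.
- by drop_heavy (a + c'); drop_heavy (b + b'); count_heavy.
- by drop_heavy (c + a'); drop_heavy (b + b'); count_heavy.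
- by exfalso; lra.
Qed.

Lemma heavy3CA e f g : heavy3 e f g = heavy3 f e g.
Proof.
rewrite /heavy3 exchange_big/=; apply: eq_bigr => y _; apply: eq_bigr => x _.
by apply: eq_bigr => z _; rewrite [x + y]addrC.
Qed.

Lemma heavy3AC e f g : heavy3 e f g = heavy3 e g f.
Proof.
rewrite /heavy3; apply: eq_bigr => x _; rewrite exchange_big/=.
by apply: eq_bigr => z _; apply: eq_bigr => y _; rewrite addrAC.
Qed.

Lemma perm_heavy3 e e' f g : perm_eq e e' -> heavy3 e f g = heavy3 e' f g.
Proof. by move=> p; apply: perm_big. Qed.

Lemma heavy2C e f : heavy2 e f = heavy2 f e.
Proof.
rewrite /heavy2 exchange_big/=; apply: eq_bigr => y _; apply: eq_bigr => x _.
by rewrite addrC.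
Qed.

Lemma perm_heavy2 e e' f : perm_eq e e' -> heavy2 e f = heavy2 e' f.
Proof. by move=> p; apply: perm_big. Qed.

(** As the triples are sorted, [b1 + a2 + c3] dominates the six sums that use [b1] or [c1], any
    entry of the second triple, and [c3]. *)
Lemma heavy3_six_light a1 b1 c1 a2 b2 c2 a3 b3 c3 :
  distr3 a1 b1 c1 -> distr3 a2 b2 c2 -> distr3 a3 b3 c3 -> b1 + a2 + c3 < 1 ->
  heavy3 [:: a1; b1; c1] [:: a2; b2; c2] [:: a3; b3; c3] <= 21.
Proof.
move=> [ab1 bc1 c10 s1] [ab2 bc2 c20 s2] [ab3 bc3 c30 s3] lt1; expand_heavy.
drop_heavy (b1 + a2 + c3); drop_heavy (b1 + b2 + c3); drop_heavy (b1 + c2 + c3).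
drop_heavy (c1 + a2 + c3); drop_heavy (c1 + b2 + c3); drop_heavy (c1 + c2 + c3).
count_heavy.
Qed.

(** In [heavy3_le21] the [p] stand for the sums of one smallest and two middle entries, the [q] for
    those of one largest and two smallest. The sums in an excluded combination add up to less than
    their number unless all nine weights are 1/3. *)
Lemma six_bools (p1 p2 p3 q1 q2 q3 : bool) :
  ~~ [&& p1, p2, p3, q1 & q2] -> ~~ [&& p1, p2, p3, q1 & q3] ->
  ~~ [&& p1, p2, p3, q2 & q3] -> ~~ [&& q1, q2, q3 & p1] ->
  ~~ [&& q1, q2, q3 & p2] -> ~~ [&& q1, q2, q3 & p3] ->
  (p1 + p2 + p3 + q1 + q2 + q3 <= 4)%N.
Proof. by case: p1; case: p2; case: p3; case: q1; case: q2; case: q3. Qed.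

Lemma heavy3_le21 a1 b1 c1 a2 b2 c2 a3 b3 c3 :
  distr3 a1 b1 c1 -> distr3 a2 b2 c2 -> distr3 a3 b3 c3 -> c1 + c2 + c3 < 1 ->
  heavy3 [:: a1; b1; c1] [:: a2; b2; c2] [:: a3; b3; c3] <= 21.
Proof.
move=> d1 d2 d3 out.
have [H|H] := ltP (b1 + a2 + c3) 1; first exact: heavy3_six_light.
have [H'|H'] := ltP (a1 + b2 + c3) 1.
  by rewrite heavy3CA heavy3_six_light //; lra.
(* The two heavy sums give [c1 + c2 <= 2 * c3], hence [c1 + c2 + b3 <= 2 * c3 + b3 <= 1]; equality
   would make all the weights involved 1/3, against [out]. *)
have out3 : c1 + c2 + b3 < 1.
  case: d1 d2 d3 => [? ? ? ?] [? ? ? ?] [? ? ? ?]; lra.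
move: H H' => _ _.
have [H|H] := ltP (b1 + c2 + a3) 1.
  by rewrite heavy3AC heavy3_six_light //; lra.
have [H'|H'] := ltP (a1 + c2 + b3) 1.
  by rewrite heavy3AC heavy3CA heavy3_six_light //; lra.
have out2 : c1 + b2 + c3 < 1.
  case: d1 d2 d3 => [? ? ? ?] [? ? ? ?] [? ? ? ?]; lra.
move: H H' => _ _.
have [H|H] := ltP (c1 + b2 + a3) 1.
  by rewrite heavy3CA heavy3AC heavy3_six_light //; lra.
have [H'|H'] := ltP (c1 + a2 + b3) 1.
  by rewrite heavy3CA heavy3AC heavy3CA heavy3_six_light //; lra.
have out1 : b1 + c2 + c3 < 1.
  case: d1 d2 d3 => [? ? ? ?] [? ? ? ?] [? ? ? ?]; lra.
move: H H' => _ _.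
case: d1 d2 d3 => [ab1 bc1 c10 s1] [ab2 bc2 c20 s2] [ab3 bc3 c30 s3].
(* Four of the 27 sums are light by [out], [out1], [out2] and [out3]. Of the six considered here at
   most four are heavy, and the other 17 are counted in full. *)
have : heavy (c1 + b2 + b3) + heavy (b1 + c2 + b3) + heavy (b1 + b2 + c3) + heavy (c1 + c2 + a3) + heavy (c1 + a2 + c3) + heavy (a1 + c2 + c3) <= 4.
  rewrite /heavy -!natrD (ler_nat _ _ 4).
  by apply: six_bools; apply/negP;
    first [move=> /and5P[] *; lra | move=> /and4P[] *; lra].
have : \sum_(s <- [:: a1 + a2 + a3; a1 + a2 + b3; a1 + a2 + c3; a1 + b2 + a3; a1 + b2 + b3; a1 + b2 + c3; a1 + c2 + a3; a1 + c2 + b3; b1 + a2 + a3; b1 + a2 + b3; b1 + a2 + c3; b1 + b2 + a3; b1 + b2 + b3; b1 + c2 + a3; c1 + a2 + a3; c1 + a2 + b3; c1 + b2 + a3]) heavy s <= 17.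
  by rewrite !big_cons big_nil addr0; count_heavy.
expand_heavy; drop_heavy (c1 + c2 + c3); drop_heavy (b1 + c2 + c3); drop_heavy (c1 + b2 + c3); drop_heavy (c1 + c2 + b3).
clear.
repeat match goal with |- context[heavy ?s] => move: (heavy s) => ? end.
lra.
Qed.

(* [u] is a mass placed at weight 0.  In [heavy_poly_bound], 27 is attained by
   three triples (1/3, 1/3, 1/3), the clique, and 19 + 15 u + 3 u^2 by three
   triples (1, 0, 0), the star; the two bounds are separated at u = 1/2. *)
Definition heavy_poly (f1 f2 f3 : seq R) u :=
  heavy3 f1 f2 f3 + u * (heavy2 f1 f2 + heavy2 f1 f3 + heavy2 f2 f3)
  + u ^+ 2 * (heavy1 f1 + heavy1 f2 + heavy1 f3).

Lemma heavy1_le1 a b c : distr3 a b c -> heavy1 [:: a; b; c] <= 1.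
Proof.
move=> [ab bc c0 s]; expand_heavy.
by drop_heavy b; drop_heavy c; count_heavy.
Qed.

(** The entry 1 leaves two zeros: it contributes at most 9, and each zero contributes the pairs of
    the other two triples, at most 5. *)
Lemma heavy3_le19 b1 c1 a2 b2 c2 a3 b3 c3 :
  distr3 1 b1 c1 -> distr3 a2 b2 c2 -> distr3 a3 b3 c3 ->
  heavy3 [:: 1; b1; c1] [:: a2; b2; c2] [:: a3; b3; c3] <= 19.
Proof.
move=> [? ? ? ?] d2 d3; have := heavy2_le5 d2 d3.
have [-> ->] : b1 = 0 /\ c1 = 0 by split; lra.
have K f g : heavy3 [:: 1; 0; 0] f g =
    \sum_(x <- f) \sum_(y <- g) heavy (1 + x + y) + 2 * heavy2 f g.
  rewrite /heavy3 !big_cons big_nil addr0.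
  have -> : \sum_(x <- f) \sum_(y <- g) heavy (0 + x + y) = heavy2 f g.
    by apply: eq_bigr => x _; apply: eq_bigr => y _; rewrite add0r.
  by ring.
rewrite K => le5.
have : \sum_(x <- [:: a2; b2; c2]) \sum_(y <- [:: a3; b3; c3]) heavy (1 + x + y) <= 9.
  by rewrite !big_cons !big_nil; count_heavy.
lra.
Qed.

Section Triples.
Variables a1 b1 c1 a2 b2 c2 a3 b3 c3 : R.
Hypothesis d1 : distr3 a1 b1 c1.
Hypothesis d2 : distr3 a2 b2 c2.
Hypothesis d3 : distr3 a3 b3 c3.
Let e1 := [:: a1; b1; c1]. Let e2 := [:: a2; b2; c2]. Let e3 := [:: a3; b3; c3].

Lemma heavy_poly_le19 u : 0 <= u -> heavy3 e1 e2 e3 <= 19 ->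
  heavy_poly e1 e2 e3 u <= 19 + 15 * u + 3 * u ^+ 2.
Proof.
move=> u0 le19; rewrite /heavy_poly.
have h12 := heavy2_le5 d1 d2; have h13 := heavy2_le5 d1 d3; have h23 := heavy2_le5 d2 d3.
have h1 := heavy1_le1 d1; have h2 := heavy1_le1 d2; have h3 := heavy1_le1 d3.
rewrite -/e1 -/e2 -/e3 in h12 h13 h23 h1 h2 h3.
have : u * (heavy2 e1 e2 + heavy2 e1 e3 + heavy2 e2 e3) <= u * 15.
  by apply: ler_wpM2l => //; lra.
have : u ^+ 2 * (heavy1 e1 + heavy1 e2 + heavy1 e3) <= u ^+ 2 * 3.
  by apply: ler_wpM2l; [exact: sqr_ge0 | lra].
lra.
Qed.

Lemma heavy_poly_sorted u : 0 <= u ->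
  heavy_poly e1 e2 e3 u <= Num.max 27 (19 + 15 * u + 3 * u ^+ 2).
Proof.
move=> u0; rewrite le_max.
have [le19|gt19] := leP (heavy3 e1 e2 e3) 19.
  by apply/orP; right; apply: heavy_poly_le19.
have ale a b c : distr3 a b c -> a <= 1 by move=> [? ? ? ?]; lra.
have na1 : a1 < 1.
  rewrite lt_neqAle (ale _ _ _ d1) andbT; apply: contraTneq gt19 => E.
  by move: d1; rewrite -leNgt /e1 E => d1'; apply: heavy3_le19.
have na2 : a2 < 1.
  rewrite lt_neqAle (ale _ _ _ d2) andbT; apply: contraTneq gt19 => E.
  by move: d2; rewrite -leNgt /e2 E heavy3CA => d2'; apply: heavy3_le19.
have na3 : a3 < 1.
  rewrite lt_neqAle (ale _ _ _ d3) andbT; apply: contraTneq gt19 => E.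
  by move: d3; rewrite -leNgt /e3 E heavy3AC heavy3CA => d3'; apply: heavy3_le19.
have h1 a b c : distr3 a b c -> a < 1 -> heavy1 [:: a; b; c] = 0.
  by move=> [? ? ? ?] ?; expand_heavy; rewrite !heavy_eq0 ?addr0 //; lra.
rewrite /heavy_poly (h1 _ _ _ d1) // (h1 _ _ _ d2) // (h1 _ _ _ d3) // !addr0 mulr0 addr0.
(* Smallest entries of sum at least 1 occur only when all nine weights are 1/3: then no pair is
   heavy and the trivial bound 27 suffices. *)
have [ge|lt] := leP 1 (c1 + c2 + c3).
  apply/orP; left.
  have h2 a b c a' b' c' : distr3 a b c -> distr3 a' b' c' -> a = 3^-1 -> a' = 3^-1 ->
     heavy2 [:: a; b; c] [:: a'; b'; c'] = 0.
    by move=> [? ? ? ?] [? ? ? ?] ? ?; expand_heavy; rewrite !heavy_eq0 ?addr0 //; lra.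
  have [E1 E2 E3] : [/\ a1 = 3^-1, a2 = 3^-1 & a3 = 3^-1].
    by case: d1 d2 d3 => [? ? ? ?] [? ? ? ?] [? ? ? ?]; split; lra.
  rewrite (h2 _ _ _ _ _ _ d1 d2) // (h2 _ _ _ _ _ _ d1 d3) // (h2 _ _ _ _ _ _ d2 d3) //.
  by rewrite !addr0 mulr0 addr0; expand_heavy; count_heavy.
(* The total is now at most [21 + 12 * u], which is at most 27 for [u <= 1/2] and at most
   [19 + 15 * u + 3 * u ^+ 2] from 1/2 on. *)
have le21 := heavy3_le21 d1 d2 d3 lt.
have h12 := heavy2_le4 d1 d2 na1; have h13 := heavy2_le4 d1 d3 na1.
have h23 := heavy2_le4 d2 d3 na2; rewrite -/e1 -/e2 -/e3 in h12 h13 h23.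
have le12 : u * (heavy2 e1 e2 + heavy2 e1 e3 + heavy2 e2 e3) <= u * 12.
  by apply: ler_wpM2l => //; lra.
have [ule|ugt] := leP u (2^-1).
  by apply/orP; left; rewrite -/e1 -/e2 -/e3 in le21 *; lra.
by apply/orP; right; rewrite -/e1 -/e2 -/e3 in le21 *; nra.
Qed.
End Triples.

Lemma heavy_poly_bound a1 b1 c1 a2 b2 c2 a3 b3 c3 u :
  [/\ 0 <= a1, 0 <= b1, 0 <= c1 & a1 + b1 + c1 = 1] ->
  [/\ 0 <= a2, 0 <= b2, 0 <= c2 & a2 + b2 + c2 = 1] ->
  [/\ 0 <= a3, 0 <= b3, 0 <= c3 & a3 + b3 + c3 = 1] ->
  0 <= u ->
  heavy_poly [:: a1; b1; c1] [:: a2; b2; c2] [:: a3; b3; c3] u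
    <= Num.max 27 (19 + 15 * u + 3 * u ^+ 2).
Proof.
have srt (a b c : R) : [/\ 0 <= a, 0 <= b, 0 <= c & a + b + c = 1] ->
    exists a' b' c', perm_eq [:: a; b; c] [:: a'; b'; c'] /\ distr3 a' b' c'.
  move=> [a0 b0 c0 s1].
  pose l := sort (fun x y => y <= x) [:: a; b; c].
  have pl : perm_eq [:: a; b; c] l by rewrite perm_sym perm_sort.
  have : sorted (fun x y => y <= x) l by apply: sort_sorted => x y; apply: le_total.
  have sz : size l = 3 by rewrite size_sort.
  have s0 : all (fun x => 0 <= x) l.
    by rewrite -(perm_all _ pl) /= a0 b0 c0.
  have ls : \sum_(x <- l) x = 1.
    by rewrite -(perm_big _ pl) !big_cons big_nil /= addr0 addrA.
  case: l pl sz s0 ls => [|x [|y [|z []]]] //= pl _ /and4P[_ _ z0 _].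
  rewrite !big_cons big_nil addr0 addrA => ls /and3P[yx zy _].
  by exists x, y, z; split.
move=> /srt[x1 [y1 [z1 [p1 d1]]]] /srt[x2 [y2 [z2 [p2 d2]]]] /srt[x3 [y3 [z3 [p3 d3]]]] u0.
apply: le_trans (heavy_poly_sorted d1 d2 d3 u0).
rewrite /heavy_poly (perm_heavy3 _ _ p1) heavy3CA (perm_heavy3 _ _ p2) heavy3CA.
rewrite heavy3AC heavy3CA (perm_heavy3 _ _ p3) heavy3CA heavy3AC.
rewrite !(perm_heavy2 _ p1) ![heavy2 _ [:: a2; _; _]]heavy2C !(perm_heavy2 _ p2).
rewrite ![heavy2 _ [:: a3; _; _]]heavy2C !(perm_heavy2 _ p3).
rewrite /heavy1 (perm_big _ p1) (perm_big _ p2) (perm_big _ p3) -!/(heavy1 _).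
by rewrite ![heavy2 [:: x3; _; _] _]heavy2C [heavy2 [:: x2; _; _] [:: x1; _; _]]heavy2C.
Qed.
End Local.

(** * Fractional covers of 3-graphs *)

Section Covers.
Variables (R : realFieldType) (I J : finType) (a b c : J -> I).
Variables (w : I -> R) (p : J -> R).
Let m i : R := \sum_j p j * ((a j == i)%:R + (b j == i)%:R + (c j == i)%:R).
Hypothesis w_ge0 : forall i, 0 <= w i.
Hypothesis p_ge0 : forall j, 0 <= p j.
Hypothesis m_le1 : forall i, m i <= 1.
Hypothesis w_ge1 : forall j, 1 <= w (a j) + w (b j) + w (c j).
Hypothesis w_le_p : \sum_i w i <= \sum_j p j.
Let t : R := #|I|%:R.
Let tau := \sum_j p j.

Let sum_m (F : I -> R) : \sum_i m i * F i = \sum_j p j * (F (a j) + F (b j) + F (c j)).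
Proof.
have delta (k : I) : \sum_i (k == i)%:R * F i = F k.
  rewrite (bigD1 k)//= eqxx mul1r big1 ?addr0// => i ik.
  by rewrite eq_sym (negPf ik) mul0r.
under eq_bigr do rewrite mulr_suml; rewrite exchange_big/=.
apply: eq_bigr => j _; rewrite -[F (a j)]delta -[F (b j)]delta -[F (c j)]delta.
rewrite -!big_split mulr_sumr; apply: eq_bigr => i _ /=; ring.
Qed.

Lemma fractional_matching_le : 3 * tau <= t.
Proof.
have -> : 3 * tau = \sum_i m i.
  transitivity (\sum_i m i * 1); last by apply: eq_bigr => i _; rewrite mulr1.
  by rewrite sum_m mulr_sumr; apply: eq_bigr => j _; ring.
by rewrite /t -sumr_const; apply: ler_sum => i _; apply: m_le1.
Qed.

Let slack : (forall j, p j != 0 -> w (a j) + w (b j) + w (c j) = 1) /\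
  (forall i, (1 - m i) * w i = 0).
Proof.
have A_ge0 j : 0 <= p j * (w (a j) + w (b j) + w (c j) - 1).
  by rewrite mulr_ge0// subr_ge0.
have B_ge0 i : 0 <= (1 - m i) * w i by rewrite mulr_ge0// subr_ge0.
have E : \sum_j p j * (w (a j) + w (b j) + w (c j) - 1) + \sum_i (1 - m i) * w i
    = \sum_i w i - tau.
  under eq_bigr do rewrite mulrBr mulr1.
  under [X in _ + X]eq_bigr do rewrite mulrBl mul1r.
  rewrite !sumrB sum_m /tau; ring.
have A0 : \sum_j p j * (w (a j) + w (b j) + w (c j) - 1) >= 0 by apply: sumr_ge0.
have B0 : \sum_i (1 - m i) * w i >= 0 by apply: sumr_ge0.
have le0 : \sum_i w i - tau <= 0 by rewrite subr_le0.
split.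
  move=> j pj; have /eqP : \sum_j p j * (w (a j) + w (b j) + w (c j) - 1) = 0 by lra.
  rewrite psumr_eq0// => /allP/(_ j (mem_index_enum _))/=.
  by rewrite mulf_eq0 (negPf pj)/= subr_eq0 => /eqP.
move=> i; have /eqP : \sum_i (1 - m i) * w i = 0 by lra.
by rewrite psumr_eq0// => /allP/(_ i (mem_index_enum _))/= /eqP.
Qed.

(* Complementary slackness writes the counting measure on [I] as a mixture of
   measures, each made of a triple of total weight 1 and of mass [u] at
   weight 0. *)
Lemma heavy_triples_le :
  \sum_i \sum_j \sum_k heavy (w i + w j + w k)
    <= Num.max (27 * tau ^+ 3) (t ^+ 3 - (t - tau) ^+ 3).
Proof.
have [tight mw0] := slack.
have tau_ge0 : 0 <= tau by apply: sumr_ge0.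
have [tau_gt0|] := ltP 0 tau; last first.
  move=> tau_le0; have tau0 : tau = 0 by apply/eqP; rewrite eq_le tau_le0.
  have w0 i : w i = 0.
    apply/eqP; rewrite eq_le w_ge0 andbT -tau0; apply: le_trans w_le_p.
    by rewrite (bigD1 i)//= lerDl sumr_ge0.
  rewrite le_max big1 ?tau0 ?expr0n ?mulr0 ?lexx// => i _.
  by rewrite big1// => j _; rewrite big1// => k _; rewrite !w0 !addr0 heavy_eq0.
(* A point of degree [m i < 1] has weight 0 by complementary slackness. The missing degree,
   [t - 3 * tau] in total, therefore sits at weight 0 and is shared out in proportion to [p]. *)
pose u := (t - 3 * tau) / tau.
have u_ge0 : 0 <= u by rewrite divr_ge0// subr_ge0 fractional_matching_le.
pose L j (G : R -> R) := G (w (a j)) + G (w (b j)) + G (w (c j)) + u * G 0.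
have LE j G : L j G = G (w (a j)) + G (w (b j)) + G (w (c j)) + u * G 0 by [].
have sumL (G : R -> R) : \sum_i G (w i) = \sum_j p j * L j G.
  have -> : \sum_i G (w i) = \sum_i m i * G (w i) + \sum_i (1 - m i) * G 0.
    rewrite -big_split; apply: eq_bigr => i _ /=.
    have /eqP := mw0 i; rewrite mulf_eq0 => /orP[/eqP mi|/eqP ->]; last by ring.
    rewrite mi; have -> : m i = 1 by lra.
    by ring.
  rewrite (sum_m (fun i => G (w i))) -mulr_suml sumrB sumr_const -[_%:R]/t.
  have -> : \sum_i m i = 3 * tau.
    transitivity (\sum_i m i * 1); first by apply: eq_bigr => i _; rewrite mulr1.
    by rewrite sum_m mulr_sumr; apply: eq_bigr => j _; ring.
  have -> : (t - 3 * tau) * G 0 = \sum_j p j * (u * G 0).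
    by rewrite -mulr_suml mulrA; congr (_ * _); rewrite [RHS]mulrC /u divfK// gt_eqF.
  by rewrite -big_split; apply: eq_bigr => j _ /=; rewrite /L; ring.
have -> : \sum_i \sum_j \sum_k heavy (w i + w j + w k) =
  \sum_i \sum_j \sum_k p i * p j * p k *
    L i (fun x => L j (fun y => L k (fun z => heavy (x + y + z)))).
  rewrite (sumL (fun x => \sum_j \sum_k heavy (x + w j + w k))).
  apply: eq_bigr => i _.
  have E x : \sum_j \sum_k heavy (x + w j + w k) =
     \sum_j \sum_k p j * p k * L j (fun y => L k (fun z => heavy (x + y + z))).
    rewrite (sumL (fun y => \sum_k heavy (x + y + w k))); apply: eq_bigr => j _.
    have E' y : \sum_k heavy (x + y + w k) = \sum_k p k * L k (fun z => heavy (x + y + z)).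
      by rewrite -(sumL (fun z => heavy (x + y + z))).
    rewrite [in LHS]LE !E' mulr_sumr -!big_split/= mulr_sumr; apply: eq_bigr => k _.
    by rewrite [in RHS]LE; ring.
  rewrite [in LHS]LE !E mulr_sumr -!big_split/= mulr_sumr; apply: eq_bigr => j _.
  rewrite mulr_sumr -!big_split/= mulr_sumr; apply: eq_bigr => k _.
  by rewrite [in RHS]LE; ring.
set mx := Num.max 27 (19 + 15 * u + 3 * u ^+ 2).
suff le_mx : \sum_i \sum_j \sum_k p i * p j * p k *
    L i (fun x => L j (fun y => L k (fun z => heavy (x + y + z)))) <=
   tau ^+ 3 * mx.
  (* Since [t = (3 + u) * tau], the star bound is [(3 + u) ^ 3 - (2 + u) ^ 3 = 19 + 15 * u + 3 * u ^
     2] in units of [tau ^ 3]. *)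
  apply: le_trans le_mx _; rewrite maxr_pMr ?exprn_ge0// le_max !ge_max.
  rewrite /mx; have tn0 : tau != 0 by rewrite gt_eqF.
  have -> : tau ^+ 3 * 27 = 27 * tau ^+ 3 by ring.
  have -> : tau ^+ 3 * (19 + 15 * u + 3 * u ^+ 2) = t ^+ 3 - (t - tau) ^+ 3.
    by rewrite /u; field.
  by rewrite !lexx/= andbT; case: leP => //= /ltW.
have -> : tau ^+ 3 * mx = \sum_i \sum_j \sum_k p i * p j * p k * mx.
  under eq_bigr => i _.
    under eq_bigr => j _.
      rewrite -mulr_suml -mulr_sumr -/tau; over.
    rewrite -!mulr_suml -mulr_sumr -/tau; over.
  by rewrite -!mulr_suml -/tau; ring.
apply: ler_sum => i _; apply: ler_sum => j _; apply: ler_sum => k _.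
have [/eqP|] := boolP (p i * p j * p k == 0); first by move->; rewrite !mul0r.
rewrite !mulf_eq0 !negb_or => /andP[/andP[pi pj] pk].
apply: ler_wpM2l; first by rewrite !mulr_ge0.
have d l : p l != 0 -> [/\ 0 <= w (a l), 0 <= w (b l), 0 <= w (c l)
   & w (a l) + w (b l) + w (c l) = 1] by move=> pl; split=> //; apply: tight.
apply: le_trans (heavy_poly_bound (d i pi) (d j pj) (d k pk) u_ge0).
rewrite le_eqVlt; apply/orP; left; apply/eqP.
rewrite /heavy_poly /heavy3 /heavy2 /heavy1 !big_cons !big_nil /L !addr0 !add0r.
have -> : heavy (0 : R) = 0 by apply: heavy_eq0.
ring.
Qed.
End Covers.

(** * Random samples *)

Section Resample.
Variables (I U : finType).
Implicit Types v : {ffun I -> U}.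

Definition upd v i x : {ffun I -> U} := [ffun k => if k == i then x else v k].

Lemma updE v i x : upd v i x i = x.
Proof. by rewrite ffunE eqxx. Qed.

Lemma updN v i x k : k != i -> upd v i x k = v k.
Proof. by rewrite ffunE => /negPf ->. Qed.

Lemma upd_upd v i x y : upd (upd v i x) i y = upd v i y.
Proof. by apply/ffunP => k; rewrite !ffunE; case: eqP. Qed.

Lemma upd_id v i : upd v i (v i) = v.
Proof. by apply/ffunP => k; rewrite ffunE; case: eqP => // ->. Qed.

(** Exchanging [x] with [v i] is an involution on the pairs [(v, x)]. Independence of the
    coordinates is used only in this form. *)
Lemma sum_resample (R : nzRingType) (F : {ffun I -> U} -> R) i :
  \sum_v \sum_x F (upd v i x) = #|U|%:R * \sum_v F v.
Proof.
rewrite pair_big/= (reindex_inj (h := fun q => (upd q.1 i q.2, q.1 i)))/=; last first.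
  apply: (can_inj (g := fun q => (upd q.1 i q.2, q.1 i))) => -[v x] /=.
  by rewrite upd_upd upd_id updE.
under eq_bigr do rewrite upd_upd upd_id.
rewrite -(pair_big xpredT xpredT (fun v _ => F v))/= mulr_sumr.
by apply: eq_bigr => v _; rewrite sumr_const mulr_natl.
Qed.
End Resample.

Section Sampling.
Variables (R : realFieldType) (I U : finType) (h : U -> U -> U -> bool).
Hypothesis U_gt0 : (0 < #|U|)%N.
Let N : R := #|U|%:R.
Let t : R := #|I|%:R.
Let T : R := #|{ffun I -> U}|%:R.
Let g a b c : R := (h a b c)%:R.

Definition triples : R := \sum_a \sum_b \sum_c g a b c.
Definition degree a : R := \sum_b \sum_c g a b c.
Definition density : R := triples / N ^+ 3.
Definition pulled_triples (v : {ffun I -> U}) : R :=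
  \sum_i \sum_j \sum_k g (v i) (v j) (v k).

Let N_gt0 : 0 < N. Proof. by rewrite ltr0n. Qed.
Let t_ge0 : 0 <= t. Proof. exact: ler0n. Qed.
Let T_ge0 : 0 <= T. Proof. exact: ler0n. Qed.
Let d := density.
Let X a b c := g a b c - d.

Let sum1 (K : finType) (x : R) : \sum_(i : K) x = #|K|%:R * x.
Proof. by rewrite sumr_const mulr_natl. Qed.

Lemma density_ge0 : 0 <= density.
Proof.
rewrite divr_ge0 ?exprn_ge0 ?ler0n// /triples.
by apply: sumr_ge0 => a _; apply: sumr_ge0 => b _; apply: sumr_ge0 => c _; apply: ler0n.
Qed.

Lemma triplesE : triples = density * N ^+ 3.
Proof. by rewrite /density divfK// expf_neq0// gt_eqF. Qed.

Lemma density_le1 : density <= 1.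
Proof.
rewrite ler_pdivrMr ?exprn_gt0// mul1r.
have -> : N ^+ 3 = \sum_(a : U) \sum_(b : U) \sum_(c : U) 1 by rewrite !sum1; ring.
apply: ler_sum => a _; apply: ler_sum => b _; apply: ler_sum => c _.
by rewrite /g; case: (h a b c); rewrite ?ler01.
Qed.

Let sumX : \sum_a \sum_b \sum_c X a b c = 0.
Proof.
rewrite /X; under eq_bigr do under eq_bigr do rewrite sumrB.
under eq_bigr do rewrite sumrB.
by rewrite sumrB -/triples triplesE !sum1 -/d -/N; ring.
Qed.

Let X_le1 a b c : `|X a b c| <= 1.
Proof.
have := density_ge0; have := density_le1; rewrite /X /g -/d.
by case: (h a b c) => /= *; rewrite ler_norml; apply/andP; split; lra.
Qed.

Let E2 i j k l m n := \sum_(v : {ffun I -> U})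
   X (v i) (v j) (v k) * X (v l) (v m) (v n).

Let E2_0 i j k l m n : j != i -> k != i -> k != j ->
  l != i -> m != i -> n != i -> l != j -> m != j -> n != j ->
  l != k -> m != k -> n != k -> E2 i j k l m n = 0.
Proof.
move=> ji ki kj li mi ni lj mj nj lk mk nk.
suff : N * (N * (N * E2 i j k l m n)) = 0.
  by move=> /eqP; rewrite !mulf_eq0 gt_eqF//= => /eqP.
rewrite /E2 -(sum_resample _ i).
under eq_bigr do under eq_bigr do rewrite !updE !updN//.
rewrite -(sum_resample _ j).
under eq_bigr do under eq_bigr do under eq_bigr do rewrite !updE !updN//.
rewrite -(sum_resample _ k).
under eq_bigr do under eq_bigr do under eq_bigr do under eq_bigr do
  rewrite !updE !updN//.
apply: big1 => v _.
transitivity (\sum_(c : U) \sum_(b : U) \sum_(a : U) X a b c * X (v l) (v m) (v n)); first by [].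
rewrite exchange_big/=; under eq_bigr do rewrite exchange_big/=.
rewrite exchange_big/=; under eq_bigr do under eq_bigr do rewrite -mulr_suml.
under eq_bigr do rewrite -mulr_suml.
by rewrite -mulr_suml sumX mul0r.
Qed.

Let hit (i j : I) : R := (i == j)%:R.
(** These are the coincidences that touch [i], [j] or [k]. In their absence, averaging over these
    three coordinates alone kills the centred first factor while the second stays fixed. Their 12
    pairs give the 12 of the variance bound. *)
Let hits i j k l m n := hit i j + hit i k + hit j k +
  (hit i l + hit i m + hit i n) + (hit j l + hit j m + hit j n)
   + (hit k l + hit k m + hit k n).

Let E2_le i j k l m n : E2 i j k l m n <= T * hits i j k l m n.
Proof.
have hit_ge0 x y : 0 <= hit x y by apply: ler0n.
have [/eqP hits0|hitsN0] := boolP (hits i j k l m n == 0).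
  have hit0 x y : hit x y <= 0 -> y != x.
    by rewrite /hit eq_sym; case: eqP => //= _; rewrite ler10.
  move: hits0 (hit_ge0 i j) (hit_ge0 i k) (hit_ge0 j k) (hit_ge0 i l) (hit_ge0 i m)
   (hit_ge0 i n) (hit_ge0 j l) (hit_ge0 j m) (hit_ge0 j n) (hit_ge0 k l) (hit_ge0 k m)
   (hit_ge0 k n).
  rewrite /hits => *.
  by rewrite E2_0 ?mulr_ge0 ?hit0//; lra.
have hits_ge1 : 1 <= hits i j k l m n.
  move: hitsN0; rewrite /hits /hit -!natrD pnatr_eq0 -lt0n => ?.
  by rewrite (ler_nat _ 1).
apply: (@le_trans _ _ (T * 1)); last by apply: ler_wpM2l.
rewrite /T -sum1; apply: ler_sum => v _.
apply: le_trans (ler_norm _) _; rewrite normrM -[leRHS]mulr1.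
by apply: ler_pM.
Qed.

Let sum_hitr i : \sum_j hit i j = 1.
Proof.
by rewrite (bigD1 i)//= /hit eqxx big1 ?addr0// => j /negPf; rewrite eq_sym => ->.
Qed.

Let sum_hits : \sum_i \sum_j \sum_k \sum_l \sum_m \sum_n hits i j k l m n = 12 * t ^+ 5.
Proof.
have inner i j k : \sum_l \sum_m \sum_n hits i j k l m n =
    t ^+ 3 * (hit i j + hit i k + hit j k) + 9 * t ^+ 2.
  under eq_bigr => l _.
    under eq_bigr => m _.
      rewrite /hits !big_split/= !sum_hitr !sum1; over.
    rewrite !big_split/= -!mulr_sumr !sum_hitr !sum1; over.
  by rewrite !big_split/= -!mulr_sumr -?mulr_sumr !sum_hitr !sum1; ring.
under eq_bigr do under eq_bigr do under eq_bigr do rewrite inner.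
under eq_bigr => i _.
  under eq_bigr => j _.
    rewrite !big_split/= -!mulr_sumr !big_split/= !sum_hitr !sum1; over.
  rewrite !big_split/= -!mulr_sumr !big_split/= -!mulr_sumr !sum_hitr !sum1; over.
by rewrite !sum1; ring.
Qed.

Lemma variance_pulled_triples :
  \sum_(v : {ffun I -> U}) (pulled_triples v - d * t ^+ 3) ^+ 2 <= 12 * t ^+ 5 * T.
Proof.
have Y v : pulled_triples v - d * t ^+ 3 = \sum_i \sum_j \sum_k X (v i) (v j) (v k).
  rewrite /X; under [RHS]eq_bigr do under eq_bigr do rewrite sumrB.
  under [RHS]eq_bigr do rewrite sumrB.
  by rewrite sumrB -/(pulled_triples v) !sum1; ring.
have -> : \sum_v (pulled_triples v - d * t ^+ 3) ^+ 2 =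
   \sum_i \sum_j \sum_k \sum_l \sum_m \sum_n E2 i j k l m n.
  under eq_bigr do rewrite Y expr2 mulr_suml.
  rewrite exchange_big/=; apply: eq_bigr => i _.
  under eq_bigr do rewrite mulr_suml.
  rewrite exchange_big/=; apply: eq_bigr => j _.
  under eq_bigr do rewrite mulr_suml.
  rewrite exchange_big/=; apply: eq_bigr => k _.
  under eq_bigr do rewrite mulr_sumr.
  rewrite exchange_big/=; apply: eq_bigr => l _.
  under eq_bigr do rewrite mulr_sumr.
  rewrite exchange_big/=; apply: eq_bigr => m _.
  under eq_bigr do rewrite mulr_sumr.
  by rewrite exchange_big.
rewrite -sum_hits mulrC.
rewrite mulr_sumr; apply: ler_sum => i _; rewrite mulr_sumr; apply: ler_sum => j _.
rewrite mulr_sumr; apply: ler_sum => k _; rewrite mulr_sumr; apply: ler_sum => l _.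
rewrite mulr_sumr; apply: ler_sum => m _; rewrite mulr_sumr; apply: ler_sum => n _.
exact: E2_le.
Qed.

Lemma card_pulled_deviation (e : R) : 0 < e ->
  #|[set v | pulled_triples v < (d - e) * t ^+ 3]|%:R * (e ^+ 2 * t ^+ 6)
   <= 12 * t ^+ 5 * T.
Proof.
move=> e0; apply: le_trans variance_pulled_triples.
rewrite [leRHS](bigID (mem [set v | pulled_triples v < (d - e) * t ^+ 3]))/=.
rewrite ler_wpDr//; first by apply: sumr_ge0 => *; apply: sqr_ge0.
rewrite -mulr_natl -sum1_card natr_sum mulr_suml mulr1 mulr_suml.
apply: ler_sum => v; rewrite inE mul1r => lt.
have et0 : 0 <= e * t ^+ 3 by rewrite mulr_ge0 ?exprn_ge0// ltW.
have -> : e ^+ 2 * t ^+ 6 = (e * t ^+ 3) ^+ 2 by ring.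
rewrite -[leRHS]sqrrN ler_sqr ?nnegrE//; lra.
Qed.

Lemma card_noninjective :
  #|[set v : {ffun I -> U} | ~~ injectiveb v]|%:R * N <= t ^+ 2 * T.
Proof.
have coll i j : i != j -> N * \sum_(v : {ffun I -> U}) (v i == v j)%:R = T :> R.
  move=> ij; rewrite -(sum_resample _ i) /T -[RHS]mulr1 -sum1.
  apply: eq_bigr => v _.
  under eq_bigr do rewrite !ffunE eqxx eq_sym [j == i]eq_sym (negPf ij).
  by rewrite (bigD1 (v j))//= eqxx big1 ?addr0// => x /negPf; rewrite eq_sym => ->.
have : #|[set v : {ffun I -> U} | ~~ injectiveb v]|%:R <=
   \sum_i \sum_(j | i != j) \sum_(v : {ffun I -> U}) (v i == v j)%:R :> R.
  under eq_bigr do rewrite exchange_big/=; rewrite exchange_big/=.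
  rewrite -sum1_card natr_sum [leRHS](bigID (mem [set v : {ffun I -> U} | ~~ injectiveb v]))/=.
  rewrite ler_wpDr//; first by do 3 (apply: sumr_ge0 => ? _); apply: ler0n.
  apply: ler_sum => v; rewrite inE => /injectivePn[i [j ij vij]].
  rewrite (bigD1 i)//= (bigD1 j)//= vij eqxx -addrA lerDl addr_ge0//.
    by apply: sumr_ge0 => *; apply: ler0n.
  by apply: sumr_ge0 => ? _; apply: sumr_ge0 => ? _; apply: ler0n.
move=> le; apply: (@le_trans _ _ (N * \sum_i \sum_(j | i != j) \sum_(v : {ffun I -> U}) (v i == v j)%:R)).
  by rewrite mulrC ler_wpM2l// ltW.
rewrite mulr_sumr; have -> : t ^+ 2 * T = \sum_(i : I) \sum_(j : I) T by rewrite !sum1; ring.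
apply: ler_sum => i _; rewrite mulr_sumr big_mkcond/=; apply: ler_sum => j _.
by case: ifP => // /coll ->.
Qed.

(** Markov's inequality, with [d / (d + e) <= 1 / (1 + e) <= 1 - e / 2]. It guarantees only a
    proportion [e / 2] of samples with small degree sum, so the other two exceptional sets have to
    be small compared with [e]. *)
Lemma card_large_degrees (e : R) : 0 < e -> e <= 1 -> (0 < #|I|)%N ->
  #|[set v : {ffun I -> U} | t * N ^+ 2 * (d + e) < \sum_i degree (v i)]|%:R
    <= (1 - e / 2) * T.
Proof.
move=> e0 e1 I0; set B := [set v | _].
have t_gt0 : 0 < t by rewrite ltr0n.
have sumD : N * \sum_(v : {ffun I -> U}) \sum_i degree (v i) = t * T * triples.
  rewrite exchange_big/= mulr_sumr.
  have -> : t * T * triples = \sum_(i : I) T * triples by rewrite sum1; ring.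
  apply: eq_bigr => i _; rewrite -(sum_resample _ i).
  under eq_bigr do under eq_bigr do rewrite updE.
  by rewrite sum1.
have deg_ge0 a : 0 <= degree a by do 2 (apply: sumr_ge0 => ? _); apply: ler0n.
have : #|B|%:R * (t * N ^+ 2 * (d + e)) <= \sum_(v : {ffun I -> U}) \sum_i degree (v i).
  rewrite [leRHS](bigID (mem B))/= ler_wpDr//.
    by do 2 (apply: sumr_ge0 => ? _).
  rewrite -sum1_card natr_sum mulr_suml.
  by apply: ler_sum => v; rewrite inE mul1r => /ltW.
rewrite -(ler_pM2l N_gt0) sumD triplesE -/d => le.
have tN0 : 0 < t * N ^+ 3 by rewrite mulr_gt0// exprn_gt0.
have : #|B|%:R * (d + e) <= T * d.
  rewrite -(ler_pM2l tN0); move: le; congr (_ <= _); ring.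
have d0 : 0 <= d by apply: density_ge0.
have d1 : d <= 1 by apply: density_le1.
have B0 : 0 <= #|B|%:R :> R by apply: ler0n.
move=> le2; have de0 : 0 < d + e by lra.
rewrite -(ler_pM2r de0); apply: le_trans le2 _.
have -> : (1 - e / 2) * T * (d + e) = T * ((1 - e / 2) * (d + e)) by ring.
by rewrite ler_wpM2l//; nra.
Qed.

Definition good_sample (e : R) (v : {ffun I -> U}) : bool :=
  [&& injectiveb v, (d - e) * t ^+ 3 <= pulled_triples v &
      \sum_i degree (v i) <= t * N ^+ 2 * (d + e)].

(** The constants 120 and 10 bring the Chebyshev bound [12 / (e ^ 2 * t)] and the collision bound
    [t ^ 2 / N] down to [e / 10]; there remains [e / 2 - 2 * e / 10 >= e / 4]. *)
Lemma card_good_sample (e : R) : 0 < e -> e <= 1 -> 120 <= t * e ^+ 3 ->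
  10 * t ^+ 2 <= N * e -> e / 4 * T <= #|[set v | good_sample e v]|%:R.
Proof.
move=> e0 e1 te Ne.
have t_gt0 : 0 < t by rewrite lt0r t_ge0 andbT; apply: contraTneq te => ->; rewrite mul0r -ltNge; lra.
have I0 : (0 < #|I|)%N by rewrite -(ltr0n R).
set A := [set v | pulled_triples v < (d - e) * t ^+ 3].
set B := [set v : {ffun I -> U} | t * N ^+ 2 * (d + e) < \sum_i degree (v i)].
set C := [set v : {ffun I -> U} | ~~ injectiveb v].
set G := [set v | _].
have cov : (#|{ffun I -> U}| <= #|G| + #|A| + #|B| + #|C|)%N.
  rewrite -cardsT; apply: leq_trans (_ : #|G :|: A :|: B :|: C| <= _)%N.
    apply: subset_leq_card; apply/subsetP => v _; rewrite !inE /good_sample.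
    rewrite [_ <= pulled_triples v]leNgt [\sum_i _ <= _]leNgt.
    by case: (injectiveb v); case: (_ < _); case: (_ < _).
  by do 3 (apply: leq_trans (leq_card_setU _ _) _; rewrite leq_add2r).
have covR : T <= #|G|%:R + #|A|%:R + #|B|%:R + #|C|%:R by rewrite -!natrD ler_nat.
have HB : #|B|%:R <= (1 - e / 2) * T := card_large_degrees e0 e1 I0.
have HA : #|A|%:R <= e / 10 * T.
  have t6 : 0 < e ^+ 2 * t ^+ 6 by rewrite mulr_gt0 ?exprn_gt0.
  rewrite -(ler_pM2r t6); apply: le_trans (card_pulled_deviation e0) _.
  have -> : e / 10 * T * (e ^+ 2 * t ^+ 6) = (t * e ^+ 3 / 10) * t ^+ 5 * T by field.
  by rewrite ler_wpM2r// ler_wpM2r ?exprn_ge0//; lra.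
have HC : #|C|%:R <= e / 10 * T.
  rewrite -(ler_pM2r N_gt0); apply: le_trans card_noninjective _.
  have -> : e / 10 * T * N = N * e / 10 * T by ring.
  by rewrite ler_wpM2r//; lra.
have eT : 0 <= e * T by rewrite mulr_ge0 // ltW.
lra.
Qed.
End Sampling.

(** * Complete products in dense sets of functions *)

Lemma exists_subset_card (T : finType) (B : {set T}) m : (m <= #|B|)%N ->
  exists2 Y : {set T}, Y \subset B & #|Y| = m.
Proof.
move=> mB; exists [set x in take m (enum B)].
  by apply/subsetP => x; rewrite inE => /mem_take; rewrite mem_enum.
rewrite cardsE; have /card_uniqP -> : uniq (take m (enum B)) by rewrite take_uniq ?enum_uniq.
by rewrite size_takel// -cardE.
Qed.

Section DenseProducts.
Variables (R : archiRealFieldType) (I : finType).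

Lemma pigeonhole_fibre (V K : finType) (A : {set V}) (S : {set K}) (f : V -> K) :
  (0 < #|S|)%N -> (forall v, v \in A -> f v \in S) ->
  exists2 k, k \in S & (#|A|%:R / #|S|%:R : R) <= #|[set v in A | f v == k]|%:R.
Proof.
move=> S0 fS; case/card_gt0P: (S0) => k0 Sk0.
have [k1 Sk1 max_k1] := @arg_maxnP _ k0 (mem S) (fun k => #|[set v in A | f v == k]|) Sk0.
exists k1 => //; rewrite ler_pdivrMr ?ltr0n// -natrM ler_nat.
have -> : #|A| = (\sum_(k' in S) #|[set v in A | f v == k']|)%N.
  rewrite -sum1_card (partition_big f (mem S))//=; apply: eq_bigr => k' _.
  by rewrite -sum1_card; apply: eq_bigl => v; rewrite inE.
by rewrite mulnC -sum_nat_const; apply: leq_sum => k' /max_k1.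
Qed.

Lemma dense_coordinate (e : R) (m : nat) : 0 < e ->
  exists (e' : R) (n0 : nat), 0 < e' /\
   forall (U : finType) (i : I) (A : {set {ffun I -> U}}), (n0 <= #|U|)%N ->
   e * #|{ffun I -> U}|%:R <= #|A|%:R ->
   exists Z : {set U}, #|Z| = m /\
     e' * #|{ffun I -> U}|%:R
       <= #|[set v | [forall x in Z, upd v i x \in A]]|%:R.
Proof.
move=> e0.
(* Only [M] values of the coordinate are considered, so that the pigeonhole over possible fibres
   costs [2 ^ M], independently of [U]. With [n0] elements in [U], at least [M] values are popular,
   that is, belong to [B]. *)
pose M := (Num.truncn (4 * m%:R / e)).+1.
have M0 : (0 : R) < M%:R by rewrite ltr0n.
have mM : m%:R / M%:R <= e / 4.
  have := ltW (truncnS_gt (4 * m%:R / e)); rewrite -/M ler_pdivrMr// => le.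
  rewrite ler_pdivrMr//; lra.
pose n0 := (Num.truncn (2 * M%:R / e)).+1.
exists (e / 4 / (2 ^ M)%N%:R), n0; split.
  by rewrite !divr_gt0// ltr0n expn_gt0.
move=> U i A n0U dA; set T : R := #|{ffun I -> U}|%:R in dA *.
have U0 : (0 < #|U|)%N by apply: leq_trans n0U.
have T0 : 0 < T by rewrite ltr0n; case/card_gt0P: U0 => u _; apply/card_gt0P; exists [ffun=> u].
set N : R := #|U|%:R; have N0 : 0 < N by rewrite ltr0n.
pose c x : R := \sum_(v : {ffun I -> U}) (upd v i x \in A)%:R.
have cT x : c x <= T.
  rewrite /c /T -sum1_card natr_sum; apply: ler_sum => v _.
  by case: (_ \in A); rewrite ?ler01.
have sumc : \sum_x c x = N * #|A|%:R.
  rewrite /c exchange_big/= (sum_resample (fun v => (v \in A)%:R)).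
  congr (_ * _); rewrite -sum1_card natr_sum [RHS]big_mkcond/=.
  by apply: eq_bigr => v _; case: ifP.
pose B := [set x | e / 2 * T <= c x].
have MB : (M <= #|B|)%N.
  rewrite -(ler_nat R); have H : N * (e * T) <= #|B|%:R * T + N * (e / 2 * T).
    apply: (@le_trans _ _ (N * #|A|%:R)); first by rewrite ler_wpM2l// ltW.
    rewrite -sumc (bigID (mem B))/= lerD//.
      by rewrite mulr_natl -sumr_const; apply: ler_sum.
    rewrite /N -sum1_card natr_sum mulr_suml big_mkcond/=.
    apply: ler_sum => x _; rewrite inE mul1r; case: ifP => [|_].
      by rewrite -ltNge => /ltW.
    by rewrite mulr_ge0// ?ltW//; lra.
  have n0N : 2 * M%:R / e <= N.
    apply: (@le_trans _ _ n0%:R); last by rewrite ler_nat.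
    by apply: ltW; apply: truncnS_gt.
  rewrite ler_pdivrMr// in n0N.
  by rewrite -(ler_pM2r T0); nra.
have [Y YB cY] := exists_subset_card MB.
pose fib (v : {ffun I -> U}) : {set U} := [set x in Y | upd v i x \in A].
pose V := [set v | (m <= #|fib v|)%N].
(* A fibre has on average at least [e / 2 * M] elements, and those with fewer than [m] elements
   contribute at most [m <= e / 4 * M] to this average. *)
have dV : e / 4 * T <= #|V|%:R.
  have H : M%:R * (e / 2 * T) <= M%:R * #|V|%:R + m%:R * T.
    apply: (@le_trans _ _ (\sum_(x in Y) c x)).
      rewrite -cY mulr_natl -sumr_const; apply: ler_sum => x /(subsetP YB).
      by rewrite inE.
    rewrite /c exchange_big/= (bigID (mem V))/= lerD//.
      rewrite mulrC mulr_natl -sumr_const; apply: ler_sum => v _.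
      rewrite -cY -sum1_card natr_sum; apply: ler_sum => x _.
      by case: (_ \in A); rewrite ?ler01.
    rewrite mulrC /T -sum1_card natr_sum mulr_suml big_mkcond/=.
    apply: ler_sum => v _; rewrite inE mul1r; case: ifP => [|_]; last exact: ler0n.
    rewrite -ltnNge => /ltnW le; apply: (@le_trans _ _ #|fib v|%:R); last by rewrite ler_nat.
    rewrite -sum1_card natr_sum big_mkcond [leRHS]big_mkcond/=; apply: ler_sum => x _.
    by rewrite inE; case: (x \in Y); case: (_ \in A).
  have mM' : m%:R <= e / 4 * M%:R by rewrite -ler_pdivrMr.
  rewrite -(ler_pM2l M0).
  have : m%:R * T <= e / 4 * M%:R * T by rewrite ler_wpM2r// ltW.
  lra.
pose PY : {set {set U}} := powerset Y.
have V0 : (0 < #|V|)%N.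
  by rewrite -(ltr0n R); apply: lt_le_trans dV; rewrite mulr_gt0// divr_gt0.
have [||Z ZY dZ] := @pigeonhole_fibre _ _ V PY fib.
- by apply/card_gt0P; exists set0; rewrite powersetE sub0set.
- by move=> v _; rewrite powersetE; apply/subsetP => x; rewrite inE => /andP[].
rewrite card_powerset cY in dZ.
have p2 : (0 : R) < (2 ^ M)%N%:R by rewrite ltr0n expn_gt0.
have big : e / 4 / (2 ^ M)%N%:R * T <= #|[set v in V | fib v == Z]|%:R.
  by apply: le_trans dZ; rewrite mulrAC ler_pM2r ?invr_gt0.
have mZ : (m <= #|Z|)%N.
  have : (0 < #|[set v in V | fib v == Z]|)%N.
    by rewrite -(ltr0n R); apply: lt_le_trans big; rewrite !mulr_gt0 ?divr_gt0 ?invr_gt0.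
  by case/card_gt0P => v; rewrite !inE => /andP[mv /eqP <-].
have [Z' /subsetP Z'Z cZ'] := exists_subset_card mZ.
exists Z'; split=> //; apply: le_trans big _.
rewrite ler_nat; apply/subset_leq_card/subsetP => v.
rewrite !inE => /andP[_ /eqP fZ]; apply/forall_inP => x /Z'Z.
by rewrite -fZ inE => /andP[].
Qed.

(* Coordinates are saturated one at a time; those not in [s] keep the value
   given by [v]. *)
Lemma dense_product_on (s : seq I) (e : R) (m : nat) : uniq s -> 0 < e ->
  exists n0 : nat, forall (U : finType) (A : {set {ffun I -> U}}), (n0 <= #|U|)%N ->
   e * #|{ffun I -> U}|%:R <= #|A|%:R ->
   exists (Z : I -> {set U}) (v : {ffun I -> U}),
     (forall i, i \in s -> #|Z i| = m) /\
     forall u : {ffun I -> U}, (forall i, i \in s -> u i \in Z i) ->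
        (forall i, i \notin s -> u i = v i) -> u \in A.
Proof.
elim: s e => [|i s IH] e /= us e0.
  exists 1%N => U A U0 dA; have T0 : (0 : R) < #|{ffun I -> U}|%:R.
    by rewrite ltr0n; case/card_gt0P: U0 => u _; apply/card_gt0P; exists [ffun=> u].
  have /card_gt0P[v Av] : (0 < #|A|)%N.
    by rewrite -(ltr0n R); apply: lt_le_trans dA; rewrite mulr_gt0.
  exists (fun=> set0), v; split=> // u _ uv.
  by have -> : u = v by apply/ffunP => i; apply: uv.
move: us => /andP[si us].
have [e' [n1 [e'0 step]]] := dense_coordinate m e0.
have [n2 IHs] := IH e' us e'0.
exists (maxn n1 n2) => U A; rewrite geq_max => /andP[n1U n2U] dA.
have [Zi [cZi dA']] := step U i A n1U dA.
have [Z [v [cZ prod]]] := IHs U _ n2U dA'.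
exists (fun k => if k == i then Zi else Z k), v; split.
  move=> k; rewrite inE; case: eqP => [_ _//|_ /=]; exact: cZ.
move=> u uZ uv.
have : upd u i (v i) \in [set v0 | [forall x in Zi, upd v0 i x \in A]].
  apply: prod => [k ks|k ks].
    have ki : k != i by apply: contraNneq si => <-.
    by rewrite updN//; have := uZ k; rewrite inE ks orbT (negPf ki); apply.
  have [->|ki] := eqVneq k i; first by rewrite updE.
  by rewrite updN// uv// inE negb_or ki.
rewrite inE => /forall_inP/(_ (u i)); rewrite upd_upd upd_id; apply.
by have := uZ i; rewrite inE eqxx; apply.
Qed.

Lemma dense_product (e : R) (m : nat) : 0 < e ->
  exists n0 : nat, forall (U : finType) (A : {set {ffun I -> U}}), (n0 <= #|U|)%N ->
   e * #|{ffun I -> U}|%:R <= #|A|%:R ->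
   exists Z : I -> {set U}, (forall i, #|Z i| = m) /\
     forall u : {ffun I -> U}, (forall i, u i \in Z i) -> u \in A.
Proof.
move=> e0; have [n0 H] := dense_product_on m (enum_uniq I) e0.
exists n0 => U A n0U dA; have [Z [v [cZ prod]]] := H U A n0U dA.
exists Z; split=> [i|u uZ]; first by rewrite cZ// mem_enum.
by apply: prod => // i; rewrite mem_enum.
Qed.
End DenseProducts.

(** * Packings of tight paths *)

Local Open Scope nat_scope.

Section TightPackings.
Variables (U : finType) (h : U -> U -> U -> bool).
Implicit Types (p : seq U) (ps : seq (seq U)).

Fixpoint tight p : bool :=
  if p is x :: q then (if q is y :: z :: _ then h x y z else true) && tight q
  else true.

Definition tight_packing ps := uniq (flatten ps) && all tight ps.
Definition packing_edges ps := \sum_(p <- ps) (size p - 2).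

(** Going round the three classes cyclically makes any three consecutive vertices a transversal,
    hence an edge of a complete tripartite 3-graph. *)
Fixpoint interleave (xs ys zs : seq U) : seq U :=
  match xs, ys, zs with
  | x :: xs', y :: ys', z :: zs' => x :: y :: z :: interleave xs' ys' zs'
  | _, _, _ => [::]
  end.

Lemma perm_interleave xs ys zs : size ys = size xs -> size zs = size xs ->
  perm_eq (interleave xs ys zs) (xs ++ ys ++ zs).
Proof.
elim: xs ys zs => [|x xs IH] [|y ys] [|z zs] //= [sy] [sz].
apply/permP => P; have := permP (IH ys zs sy sz) P.
by rewrite /= !count_cat /= count_cat /= => ->; ring.
Qed.

Hypothesis h12 : forall x y z, h x y z = h y x z.
Hypothesis h23 : forall x y z, h x y z = h x z y.

Lemma tight_interleave xs ys zs : size ys = size xs -> size zs = size xs ->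
  (forall x y z, x \in xs -> y \in ys -> z \in zs -> h x y z) ->
  tight (interleave xs ys zs).
Proof.
elim: xs ys zs => [|x xs IH] [|y ys] [|z zs] //= [sy] [sz] hxyz.
rewrite hxyz ?inE ?eqxx //=.
have -> : tight (interleave xs ys zs).
  by apply: IH => // x' y' z' xx yy zz; apply: hxyz; rewrite inE ?xx ?yy ?zz orbT.
case: xs ys zs sy sz hxyz {IH} => [|x' xs] [|y' ys] [|z' zs] //= _ _ hxyz.
rewrite (h23 y z) h12 hxyz ?inE ?eqxx ?orbT//=.
by rewrite h12 h23 hxyz ?inE ?eqxx ?orbT.
Qed.

Variables (I J : finType) (a b c : J -> I) (l : J -> nat).

(** Greedy allocation: each [j] takes [l j] fresh vertices from each of its three classes. The
    capacity condition passes to the remaining indices because the path of [j] removes at most the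
    share reserved for [j]. *)
Lemma allocate_tight (s : seq J) (V : I -> {set U}) :
  (forall i k x, i != k -> x \in V i -> x \notin V k) ->
  (forall j, j \in s -> [/\ a j != b j, a j != c j & b j != c j]) ->
  (forall j x y z, j \in s -> x \in V (a j) -> y \in V (b j) -> z \in V (c j) ->
      h x y z) ->
  (forall i, \sum_(j <- s) l j * ((a j == i) + (b j == i) + (c j == i)) <= #|V i|) ->
  exists ps, [/\ tight_packing ps, (forall x, x \in flatten ps -> exists i, x \in V i)
     & packing_edges ps = \sum_(j <- s) (3 * l j - 2)].
Proof.
elim: s V => [|j s IH] V dV abc hV cV.
  by exists [::]; split=> //; rewrite /packing_edges !big_nil.
pose L i := take (l j) (enum (V i)).
have LV i x : x \in L i -> x \in V i by move=> /mem_take; rewrite mem_enum.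
have uL i : uniq (L i) by rewrite take_uniq// enum_uniq.
have [nab nac nbc] : [/\ a j != b j, a j != c j & b j != c j] by apply: abc; rewrite inE eqxx.
have big_le i := cV i; have sL i : (a j == i) || (b j == i) || (c j == i) -> size (L i) = l j.
  move=> hit; rewrite size_takel// -cardE; apply: leq_trans (big_le i).
  rewrite big_cons; move: hit; case: (a j == i); case: (b j == i); case: (c j == i) => //= _; lia.
have sLa : size (L (a j)) = l j by rewrite sL ?eqxx.
have sLb : size (L (b j)) = l j by rewrite sL ?eqxx ?orbT.
have sLc : size (L (c j)) = l j by rewrite sL ?eqxx ?orbT.
pose p := interleave (L (a j)) (L (b j)) (L (c j)).
have permp : perm_eq p (L (a j) ++ L (b j) ++ L (c j)).
  by apply: perm_interleave; rewrite ?sLb ?sLc.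
pose W i := V i :\: [set x in p].
have disjL i k : i != k -> V i :&: [set x in L k] = set0.
  move=> ik; apply/setP => x; rewrite !inE; apply/negP => /andP[xi /LV xk].
  by move: (dV i k x ik xi); rewrite xk.
have cI i k : #|V i :&: [set x in L k]| <= size (L k) * (k == i).
  have [->|ki] := eqVneq k i; last by rewrite disjL ?cards0// eq_sym.
  rewrite muln1; apply: leq_trans (subset_leq_card (subsetIr _ _)) _.
  by rewrite cardsE card_size.
have [|||i|ps [/andP[ups tps] Wps eps]] := IH W.
- by move=> i k x ik; rewrite !inE => /andP[xp xi]; rewrite (negPf (dV i k x ik xi)) andbF.
- by move=> j' js; apply: abc; rewrite inE js orbT.
- move=> j' x y z js; rewrite !inE => /andP[_ xa] /andP[_ yb] /andP[_ zc].
  by apply: hV xa yb zc; rewrite inE js orbT.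
- have := cV i; rewrite big_cons /W cardsD => le.
  have : #|V i :&: [set x in p]| <= l j * ((a j == i) + (b j == i) + (c j == i)).
    have -> : [set x in p] = [set x in L (a j)] :|: ([set x in L (b j)] :|: [set x in L (c j)]).
      by apply/setP => x; rewrite !inE (perm_mem permp) !mem_cat.
    rewrite !setIUr !mulnDr; apply: leq_trans (leq_card_setU _ _) _.
    rewrite -addnA leq_add//; first by rewrite -sLa; apply: cI.
    apply: leq_trans (leq_card_setU _ _) _.
    by rewrite leq_add//; [rewrite -sLb | rewrite -sLc]; apply: cI.
  lia.
exists (p :: ps); split.
- rewrite /tight_packing /= tps andbT cat_uniq ups andbT.
  apply/andP; split; [apply/andP; split|].
  + rewrite (perm_uniq permp) !cat_uniq !uL/= andbT; apply/andP; split.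
      apply/hasPn => x; rewrite mem_cat => /orP[] /LV xV; apply/negP => /LV xa.
        by move: (dV _ _ x nab xa); rewrite xV.
      by move: (dV _ _ x nac xa); rewrite xV.
    by apply/hasPn => x /LV xV; apply/negP => /LV xb; move: (dV _ _ x nbc xb); rewrite xV.
  + by apply/hasPn => x /Wps[i]; rewrite !inE => /andP[].
  + apply: tight_interleave; rewrite ?sLb ?sLc// => x y z /LV xa /LV yb /LV zc.
    by apply: hV xa yb zc; rewrite inE eqxx.
- move=> x; rewrite /= mem_cat (perm_mem permp) !mem_cat => /orP[/or3P[]/LV|/Wps[i]].
  + by exists (a j).
  + by exists (b j).
  + by exists (c j).
  + by rewrite inE => /andP[_]; exists i.
- move: eps; rewrite /packing_edges !big_cons => ->; congr (_ - _ + _).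
  rewrite (perm_size permp) !size_cat sLa sLb sLc; lia.
Qed.
End TightPackings.

Local Open Scope ring_scope.

(** * A blow-up covered by tight paths *)

Section Step.
Variable R : archiRealFieldType.

(** For a star with [x * n] centres and a clique on [3 * x * n] vertices, these are the limit
    densities of ordered triples; [x] becomes [c / 3]. *)
Definition ex_density (x : R) : R := Num.max (27 * x ^+ 3) (1 - (1 - x) ^+ 3).

Lemma ex_density_scale (x t tau : R) : 3 * x <= 1 -> 0 <= t -> 0 <= tau -> tau <= x * t ->
  Num.max (27 * tau ^+ 3) (t ^+ 3 - (t - tau) ^+ 3) <= ex_density x * t ^+ 3.
Proof.
move=> x3 t0 tau0 taux; rewrite /ex_density maxr_pMl ?exprn_ge0//.
have x0 : 0 <= x * t by apply: le_trans taux.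
rewrite ge_max !le_max; apply/andP; split; apply/orP; [left|right].
  rewrite -mulrA -exprMn ler_pM2l// lerXn2r//.
rewrite mulrBl mul1r lerD2l lerN2 -exprMn lerXn2r ?nnegrE; nra.
Qed.

(* If the fractional matching number were at most [x t], then the covering
   weights would bound the number of edges. *)
Lemma large_fractional_matching (I : finType) (G : {set I * I * I}) (x : R) :
  3 * x <= 1 -> ex_density x * #|I|%:R ^+ 3 < #|G|%:R ->
  exists p : {q in G} -> R, [/\ forall q, 0 <= p q,
    forall i, \sum_q p q * (((val q).1.1 == i)%:R + ((val q).1.2 == i)%:R + ((val q).2 == i)%:R) <= 1
    & x * #|I|%:R < \sum_q p q].
Proof.
move=> x3 Gbig; pose J := {q in G}.
pose a (j : J) := (val j).1.1; pose b (j : J) := (val j).1.2; pose c (j : J) := (val j).2.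
pose M (j : J) i : R := (a j == i)%:R + (b j == i)%:R + (c j == i)%:R.
have M_ge0 j i : 0 <= M j i by rewrite /M !addr_ge0// ler0n.
have M_gt0 j : exists i, 0 < M j i.
  by exists (a j); rewrite /M eqxx -addrA ltr_pwDl// addr_ge0// ler0n.
have [w [p [w0 p0 mp mw wp]]] := packing_covering_duality M_ge0 M_gt0.
exists p; split=> //.
have mw' j : 1 <= w (a j) + w (b j) + w (c j).
  have delta (k : I) : \sum_i (k == i)%:R * w i = w k.
    rewrite (bigD1 k)//= eqxx mul1r big1 ?addr0// => i ik.
    by rewrite eq_sym (negPf ik) mul0r.
  apply: le_trans (mw j) _; rewrite le_eqVlt; apply/orP; left; apply/eqP.
  by under eq_bigr do rewrite /M !mulrDl; rewrite !big_split/= !delta.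
have tau0 : 0 <= \sum_j p j by apply: sumr_ge0.
rewrite ltNge; apply/negP => le.
move: Gbig; rewrite ltNge => /negP; apply.
apply: le_trans (ex_density_scale x3 (ler0n _ _) tau0 le).
apply: le_trans (heavy_triples_le w0 p0 mp mw' wp).
rewrite !pair_big/= -sum1_card natr_sum big_mkcond/=.
apply: ler_sum => q _; case: ifP => [Gq|_]; last exact: heavy_ge0.
by have := mw' (exist _ q Gq); rewrite /heavy /a /b /c /= => ->.
Qed.

Definition uniform_triples (U : finType) (h : U -> U -> U -> bool) :=
  [/\ forall x y z, h x y z = h y x z, forall x y z, h x y z = h x z y &
      forall x y z, h x y z -> [/\ x != y, x != z & y != z]].

Lemma blowup_step (x d0 e gam : R) :
  0 <= x -> 3 * x <= 1 -> 0 < e -> e <= 1 -> ex_density x < d0 - e -> 0 < gam ->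
  exists q n0 : nat, (0 < q)%N /\
   forall (U : finType) (h : U -> U -> U -> bool), uniform_triples h ->
     (n0 <= #|U|)%N -> (0 < #|U|)%N -> d0 <= density R h ->
   exists (Q : {set U}) (ps : seq (seq U)),
     [/\ #|Q| = q,
         \sum_(a in Q) degree R h a <= q%:R * #|U|%:R ^+ 2 * (density R h + e),
         tight_packing h ps, {subset flatten ps <= Q} &
         (3 * x - gam) * q%:R <= (packing_edges ps)%:R].
Proof.
move=> x0 x3 e0 e1 xd gam0.
pose t := (Num.truncn (120 / e ^+ 3)).+1; pose I := 'I_t.
have te : 120 <= t%:R * e ^+ 3.
  by rewrite -ler_pdivrMr ?exprn_gt0//; apply: ltW; apply: truncnS_gt.
have t0 : (0 : R) < t%:R by rewrite ltr0n.
(* A pattern has at most [t ^ 3] edges, and each loses at most 5 path edges: 3 by rounding down the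
   common class size and 2 at the ends of the path. This choice of [m] keeps the loss below
   [gam * (t * m)]. *)
pose m := (Num.truncn (5 * t%:R ^+ 2 / gam)).+1.
have m0 : (0 : R) < m%:R by rewrite ltr0n.
have tm : 5 * t%:R ^+ 2 <= gam * m%:R.
  by rewrite [gam * _]mulrC -ler_pdivrMr//; apply: ltW; apply: truncnS_gt.
(* The number of possible patterns of a sample depends on [t] only, so the good samples with one
   common pattern still have the positive proportion [e']. *)
pose S : {set {set I * I * I}} := setT.
have S0 : (0 < #|S|)%N by apply/card_gt0P; exists set0; rewrite inE.
pose e' := e / 4 / #|S|%:R.
have e'0 : 0 < e' by rewrite !divr_gt0// ltr0n.
have [n1 prod] := dense_product I m e'0.
pose n2 := (Num.truncn (10 * t%:R ^+ 2 / e)).+1.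
exists (t * m)%N, (maxn n1 n2); split; first by rewrite muln_gt0.
move=> U h [h12 h23 hD]; rewrite geq_max => /andP[n1U n2U] U0 hd0.
have cI : #|I| = t by rewrite card_ord.
set N : R := #|U|%:R.
have Ne : 10 * t%:R ^+ 2 <= N * e.
  rewrite -ler_pdivrMr//; apply: (@le_trans _ _ n2%:R); last by rewrite ler_nat.
  by apply: ltW; apply: truncnS_gt.
pose d := density R h.
pose good := [set v : {ffun I -> U} | good_sample h e v].
have dgood : e / 4 * #|{ffun I -> U}|%:R <= #|good|%:R.
  by apply: card_good_sample; rewrite ?cI.
pose tri (v : {ffun I -> U}) := [set q : I * I * I | h (v q.1.1) (v q.1.2) (v q.2)].
have [|G _ dG] := @pigeonhole_fibre R _ _ good S tri S0; first by move=> v _; rewrite inE.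
have [Z [cZ prodZ]] := prod U [set v in good | tri v == G] n1U (ltac:(
  by apply: le_trans dG; rewrite /e' mulrAC ler_pM2r ?invr_gt0 ?ltr0n)).
have goodP (u : {ffun I -> U}) : (forall i, u i \in Z i) -> good_sample h e u /\ tri u = G.
  by move=> /prodZ; rewrite !inE => /andP[? /eqP].
have hG (u : {ffun I -> U}) (q : I * I * I) : (forall i, u i \in Z i) -> q \in G -> h (u q.1.1) (u q.1.2) (u q.2).
  by move=> uZ; have [_ <-] := goodP u uZ; rewrite inE.
have [z0 _] : exists z0 : U, z0 \in U by apply/card_gt0P.
pose z r : {ffun I -> U} := [ffun i => nth z0 (enum (Z i)) r].
have zZ r i : (r < m)%N -> z r i \in Z i.
  by move=> rm; rewrite ffunE -mem_enum mem_nth// -cardE cZ.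
(* A vertex in two classes would extend to a non-injective transversal, whereas every transversal is
   a good sample. *)
have disjZ i k y : i != k -> y \in Z i -> y \notin Z k.
  move=> ik yi; apply/negP => yk.
  have [i'|/and3P[/injectiveP inj _ _] _] := goodP (upd (upd (z 0%N) i y) k y).
    have [->|ik'] := eqVneq i' k; first by rewrite updE.
    by rewrite updN//; have [->|?] := eqVneq i' i; rewrite ?updE// updN// zZ.
  by apply: (elimN eqP ik); apply: inj; rewrite updE updN// updE.
have dj i k : i != k -> [disjoint Z i & Z k].
  by move=> ik; rewrite disjoints_subset; apply/subsetP => y yi; rewrite inE (disjZ i).
pose Q := \bigcup_i Z i.
have sumQ (F : U -> R) : \sum_(y in Q) F y = \sum_i \sum_(y in Z i) F y.
  exact: partition_disjoint_bigcup.
have [[gz triz]] := (goodP (z 0%N) (fun i => zZ 0%N i isT), tt).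
have Gbig : ex_density x * #|I|%:R ^+ 3 < #|G|%:R.
  move: gz => /and3P[_ dz _].
  have -> : #|G|%:R = pulled_triples R h (z 0%N).
    rewrite -triz /pulled_triples !pair_big/= -sum1_card natr_sum big_mkcond/=.
    by apply: eq_bigr => q _; rewrite inE; case: ifP.
  apply: lt_le_trans dz; rewrite ltr_pM2r ?exprn_gt0 ?cI//.
  by apply: lt_le_trans xd _; rewrite lerD2r.
have [p [p0 mp taux]] := large_fractional_matching x3 Gbig.
pose J := {q in G}; have Jin (j : J) : val j \in G by case: j.
(* A class has [m] vertices and the fractional degrees are at most 1, so the rounded demands fit. *)
pose l (j : J) := Num.truncn (m%:R * p j).
have lP j : (l j)%:R <= m%:R * p j < (l j).+1%:R by apply: truncn_itv; rewrite mulr_ge0.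
have [||i|ps [tps Wps eps]] := @allocate_tight U h h12 h23 I J (fun j => (val j).1.1)
    (fun j => (val j).1.2) (fun j => (val j).2) l (index_enum J) Z disjZ.
- move=> j _; have := hG (z 0%N) (val j) (fun i => zZ 0%N i isT) (Jin j) => /hD[].
  have /and3P[/injectiveP inj _ _] := gz.
  by rewrite !(inj_eq inj).
- move=> j x1 x2 x3' _ Z1 Z2 Z3.
  have [n12 n13 n23] : [/\ (val j).1.1 != (val j).1.2, (val j).1.1 != (val j).2 & (val j).1.2 != (val j).2].
    have := hG (z 0%N) (val j) (fun i => zZ 0%N i isT) (Jin j) => /hD[].
    by have /and3P[/injectiveP inj _ _] := gz; rewrite !(inj_eq inj).
  have := hG (upd (upd (upd (z 0%N) (val j).1.1 x1) (val j).1.2 x2) (val j).2 x3') (val j) _ (Jin j).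
  rewrite [upd _ _ _ (val j).2]updE !(updN _ _ n13, updN _ _ n23, updN _ _ n12, updE); apply=> i.
  have [->|?] := eqVneq i (val j).2; first by rewrite updE.
  rewrite updN//; have [->|?] := eqVneq i (val j).1.2; first by rewrite updE.
  rewrite updN//; have [->|?] := eqVneq i (val j).1.1; first by rewrite updE.
  by rewrite updN// zZ.
- rewrite cZ -(ler_nat R) natr_sum.
  apply: (@le_trans _ _ (m%:R * \sum_q p q * (((val q).1.1 == i)%:R + ((val q).1.2 == i)%:R + ((val q).2 == i)%:R))).
    rewrite mulr_sumr; apply: ler_sum => j _.
    rewrite natrM !natrD mulrA ler_wpM2r ?addr_ge0 ?ler0n//.
    by case/andP: (lP j).
  by rewrite -[leRHS]mulr1 ler_wpM2l// ltW.
exists Q, ps; split=> //.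
- have /eqP := sumQ (fun=> 1); under [X in _ == X]eq_bigr do rewrite sumr_const cZ.
  by rewrite !sumr_const cI -mulrnA mulnC eqr_nat => /eqP.
- rewrite sumQ.
  (* The blow-up is partitioned into the [m] transversals [z r]. Each is a good sample, so their
     bounds on degree sums add up. *)
  have -> : \sum_i \sum_(y in Z i) degree R h y = \sum_(r < m) \sum_i degree R h (z r i).
    rewrite exchange_big/=; apply: eq_bigr => i _.
    rewrite -big_enum (big_nth z0) -cardE cZ big_mkord; apply: eq_bigr => r _.
    by rewrite ffunE.
  apply: (@le_trans _ _ (\sum_(r < m) t%:R * N ^+ 2 * (d + e))).
    apply: ler_sum => r _; have [/and3P[_ _]] := goodP (z r) (fun i => zZ r i (ltn_ord r)).
    by rewrite cI.
  by rewrite sumr_const card_ord natrM -mulr_natr le_eqVlt; apply/orP; left; apply/eqP; rewrite -/N -/d; ring.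
- by move=> y /Wps[i yi]; apply/bigcupP; exists i.
rewrite eps.
have cJ : #|{: J}|%:R <= t%:R ^+ 3 :> R.
  rewrite card_sig -natrX ler_nat; apply: leq_trans (max_card _) _.
  by rewrite !card_prod cI !expnS expn0 muln1 mulnA.
apply: (@le_trans _ _ (3 * m%:R * \sum_j p j - 5 * #|{: J}|%:R)).
  have : 3 * x * t%:R * m%:R <= 3 * m%:R * \sum_j p j.
    rewrite cI in taux.
    have -> : 3 * x * t%:R * m%:R = 3 * m%:R * (x * t%:R) by ring.
    by rewrite ler_pM2l ?mulr_gt0// ltW.
  rewrite natrM; have : 5 * t%:R ^+ 3 <= gam * m%:R * t%:R :> R.
    have -> : 5 * t%:R ^+ 3 = 5 * t%:R ^+ 2 * t%:R :> R by ring.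
    by rewrite ler_pM2r.
  lra.
rewrite natr_sum mulr_sumr.
have -> : 5 * #|{: J}|%:R = \sum_(j : J) 5 :> R by rewrite sumr_const mulr_natr.
rewrite -sumrB; apply: ler_sum => j _.
have /andP[_ lt] := lP j.
have : (3 * l j)%:R <= (3 * l j - 2)%:R + 2 :> R by rewrite -[2]/(2%:R) -natrD ler_nat addnC -leq_subLR.
rewrite natrM; rewrite -natr1 in lt; lra.
Qed.
End Step.

(** * Iteration *)

Section Restriction.
Variables (R : realFieldType) (U : finType) (h : U -> U -> U -> bool).
Variable Q : {set U}.
Hypothesis hU : uniform_triples h.

Definition restrict (x y z : {x in ~: Q}) := h (val x) (val y) (val z).

Lemma uniform_restrict : uniform_triples restrict.
Proof.
case: hU => h12 h23 hD; split=> [x y z|x y z|x y z /hD].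
- exact: h12.
- exact: h23.
- by rewrite !(inj_eq val_inj).
Qed.

Lemma card_restrict : #|{: {x in ~: Q}}| = (#|U| - #|Q|)%N.
Proof. by rewrite card_sig -(cardsC Q) addKn; apply: eq_card => x; rewrite !inE. Qed.

Lemma triples_restrict :
  triples R h - 3 * \sum_(a in Q) degree R h a <= triples R restrict.
Proof.
case: hU => h12 h23 _; pose g a b c : R := (h a b c)%:R.
have -> : triples R restrict =
    \sum_a \sum_b \sum_c (a \notin Q)%:R * ((b \notin Q)%:R * ((c \notin Q)%:R * g a b c)).
  have big_out (F : U -> R) : \sum_(x : {x in ~: Q}) F (val x) = \sum_x (x \notin Q)%:R * F x.
    rewrite -(big_sub (mem (~: Q)) F) big_mkcond/=; apply: eq_bigr => x _.
    by rewrite inE; case: (x \in Q); rewrite /= ?mul0r ?mul1r.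
  rewrite /triples (big_out (fun a => \sum_b \sum_c g a (val b) (val c))).
  apply: eq_bigr => a _; rewrite (big_out (fun b => \sum_c g a b (val c))) mulr_sumr.
  apply: eq_bigr => b _; rewrite (big_out (fun c => g a b c)) !mulr_sumr.
  by apply: eq_bigr => c _.
have big_in (F : U -> R) : \sum_(x in Q) F x = \sum_x (x \in Q)%:R * F x.
  by rewrite big_mkcond/=; apply: eq_bigr => x _; case: (x \in Q); rewrite ?mul0r ?mul1r.
have -> : 3 * \sum_(a in Q) degree R h a = \sum_a \sum_b \sum_c
    ((a \in Q)%:R + (b \in Q)%:R + (c \in Q)%:R) * g a b c.
  transitivity (\sum_(a in Q) degree R h a + \sum_(a in Q) degree R h a + \sum_(a in Q) degree R h a).
    by ring.
  under [RHS]eq_bigr do under eq_bigr do (under eq_bigr do rewrite !mulrDl; rewrite !big_split/=).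
  under [RHS]eq_bigr do rewrite !big_split/=.
  rewrite !big_split/= !big_in; congr (_ + _ + _).
  - apply: eq_bigr => a _; rewrite /degree mulr_sumr; apply: eq_bigr => b _.
    by rewrite mulr_sumr.
  - rewrite [RHS]exchange_big/=; apply: eq_bigr => b _; rewrite /degree mulr_sumr.
    by apply: eq_bigr => a _; rewrite mulr_sumr; apply: eq_bigr => c _; rewrite /g h12.
  - under [RHS]eq_bigr do rewrite exchange_big/=.
    rewrite [RHS]exchange_big/=; apply: eq_bigr => c _; rewrite /degree mulr_sumr.
    apply: eq_bigr => a _; rewrite mulr_sumr; apply: eq_bigr => b _.
    by rewrite /g (h12 c a b) (h23 a c b).
rewrite /triples -sumrB; apply: ler_sum => a _; rewrite -sumrB; apply: ler_sum => b _.
rewrite -sumrB; apply: ler_sum => c _.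
have : 0 <= g a b c by apply: ler0n.
by case: (a \in Q); case: (b \in Q); case: (c \in Q) => /=; rewrite -/(g a b c); lra.
Qed.

Lemma tight_map_val (p : seq {x in ~: Q}) : tight restrict p -> tight h (map val p).
Proof.
elim: p => //= x [|y [|z p]] IH //= /andP[hx /IH IHp].
by rewrite [h _ _ _]hx.
Qed.

Lemma tight_packing_cat_restrict ps ps' :
  tight_packing h ps -> {subset flatten ps <= Q} -> tight_packing restrict ps' ->
  tight_packing h (ps ++ map (map val) ps') /\
  packing_edges (ps ++ map (map val) ps') = (packing_edges ps + packing_edges ps')%N.
Proof.
move=> /andP[ups tps] psQ /andP[ups' tps']; split.
  apply/andP; split.
    rewrite flatten_cat cat_uniq ups -map_flatten map_inj_uniq ?ups' ?andbT; last exact: val_inj.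
    apply/hasPn => _ /mapP[x _ ->]; apply/negP => /psQ.
    by have := valP x; rewrite inE => /negPf ->.
  rewrite all_cat tps all_map; apply: sub_all tps' => p; exact: tight_map_val.
rewrite /packing_edges big_cat big_map; congr (_ + _)%N.
by apply: eq_bigr => p _; rewrite size_map.
Qed.
End Restriction.

Section Iterate.
Variable R : archiRealFieldType.

(** The terms [3 * q * w ^ 2 * d] cancel. What [k] has to pay is [3 * q * e * w ^ 2] for the excess
    degree and a second-order term [3 * q ^ 2 * w]; 24 is this 3 times the 8 from
    [w <= 2 * (w - q)]. *)
Lemma density_after_removal (d e w q k : R) : 0 <= d -> d <= 1 -> 0 <= e -> 0 <= q -> 2 * q <= w ->
  0 < w -> 0 <= k -> 24 * (q ^+ 2 + q * e * w) <= k * w ^+ 2 ->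
  (d - k) * (w - q) ^+ 3 <= d * w ^+ 3 - 3 * (q * w ^+ 2 * (d + e)).
Proof.
move=> d0 d1 e0 q0 qw w0 k0 le.
have w3 : w ^+ 3 <= 8 * (w - q) ^+ 3.
  have -> : 8 * (w - q) ^+ 3 = (2 * (w - q)) ^+ 3 by ring.
  by rewrite lerXn2r ?nnegrE; lra.
have kw : k * w ^+ 3 <= k * (8 * (w - q) ^+ 3) by rewrite ler_wpM2l.
have lew : 24 * (q ^+ 2 + q * e * w) * w <= k * w ^+ 2 * w by rewrite ler_wpM2r// ltW.
have dq : d * (3 * q ^+ 2 * w) <= 1 * (3 * q ^+ 2 * w).
  by rewrite ler_wpM2r// !mulr_ge0// ?sqr_ge0// ltW.
have dq3 : 0 <= d * q ^+ 3 by rewrite mulr_ge0// exprn_ge0.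
lra.
Qed.

(** As long as [w0] vertices remain, [k] bounds the density lost in one removal. The [r] pending
    removals are provided for by a surplus of [r * q] vertices and of [r * k] in density. *)
Lemma iterate_step (x d0 e gam w0 k : R) (q n0 : nat) :
  0 <= e -> 0 < w0 -> n0%:R <= w0 -> q%:R <= w0 -> 0 <= k ->
  (forall w, w0 <= w -> 24 * (q%:R ^+ 2 + q%:R * e * w) <= k * w ^+ 2) ->
  (forall (U : finType) (h : U -> U -> U -> bool), uniform_triples h ->
     (n0 <= #|U|)%N -> (0 < #|U|)%N -> d0 <= density R h ->
   exists (Q : {set U}) (ps : seq (seq U)),
     [/\ #|Q| = q,
         \sum_(a in Q) degree R h a <= q%:R * #|U|%:R ^+ 2 * (density R h + e),
         tight_packing h ps, {subset flatten ps <= Q} &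
         (3 * x - gam) * q%:R <= (packing_edges ps)%:R]) ->
  forall (r : nat) (U : finType) (h : U -> U -> U -> bool), uniform_triples h ->
    w0 + r%:R * q%:R <= #|U|%:R -> d0 + r%:R * k <= density R h ->
  exists ps, tight_packing h ps /\
     r%:R * ((3 * x - gam) * q%:R) <= (packing_edges ps)%:R.
Proof.
move=> e0 w00 n0w qw k0 kP step; elim=> [|r IH] U h hU wU dU.
  by exists [::]; split=> //; rewrite mul0r.
rewrite -natr1 in wU dU; set w : R := #|U|%:R in wU.
have r0 : 0 <= r%:R * q%:R :> R by rewrite mulr_ge0 ?ler0n.
have rk0 : 0 <= r%:R * k by rewrite mulr_ge0 ?ler0n.
have q0 : 0 <= q%:R :> R by apply: ler0n.
have w_gt0 : 0 < w by lra.
have U0 : (0 < #|U|)%N by rewrite -(ltr0n R).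
have [||Q [ps [cQ degQ tps psQ eps]]] := step U h hU _ U0.
- by rewrite -(ler_nat R); apply: le_trans n0w _; rewrite -/w; lra.
- by apply: le_trans dU; lra.
have hU' := @uniform_restrict U h Q hU.
have qU : (q <= #|U|)%N by rewrite -cQ max_card.
have cU' : #|{: {x in ~: Q}}|%:R = w - q%:R :> R by rewrite card_restrict cQ natrB.
have [||ps' [tps' eps']] := IH _ _ hU'.
- by rewrite cU'; lra.
- have := triples_restrict R Q hU.
  rewrite triplesE// -/w => le.
  have U'0 : 0 < w - q%:R by lra.
  rewrite /density cU' ler_pdivlMr ?exprn_gt0//; apply: le_trans le.
  have := @density_after_removal (density R h) e w q%:R k (density_ge0 R h) (density_le1 R h U0).
  move=> H; apply: (@le_trans _ _ ((density R h - k) * (w - q%:R) ^+ 3)).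
    by rewrite ler_pM2r ?exprn_gt0//; lra.
  apply: le_trans (H e0 q0 _ w_gt0 k0 _) _; [lra| |].
    by apply: kP; lra.
  by rewrite -/w in degQ; lra.
have [tp ep] := tight_packing_cat_restrict tps psQ tps'.
exists (ps ++ map (map val) ps'); split=> //.
by rewrite ep natrD -natr1 mulrDl mul1r addrC lerD.
Qed.

(** 9 is the slope of [27 * x ^ 3] at [x = 1/3]; the star term has slope at most 3. *)
Lemma ex_density_lip (y s : R) : 0 <= y -> 0 <= s -> 3 * (y + s) <= 1 ->
  ex_density (y + s) <= ex_density y + 9 * s.
Proof.
move=> y0 s0 ys; rewrite /ex_density ge_max; apply/andP; split.
  apply: (@le_trans _ _ (27 * y ^+ 3 + 9 * s)); last by rewrite lerD2r le_max lexx.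
  have ys2 : (3 * (y + s)) ^+ 2 <= 1 by rewrite expr_le1//; lra.
  have : s * (27 * (3 * y ^+ 2 + 3 * y * s + s ^+ 2)) <= s * 9.
    by rewrite ler_wpM2l//; nra.
  lra.
apply: (@le_trans _ _ (1 - (1 - y) ^+ 3 + 9 * s)); last by rewrite lerD2r le_max lexx orbT.
have y1 : (1 - y) ^+ 2 <= 1 by rewrite expr_le1//; lra.
have : s * (3 * (1 - y) ^+ 2 - 3 * (1 - y) * s + s ^+ 2) <= s * 3.
  by rewrite ler_wpM2l//; nra.
lra.
Qed.

Lemma dense_tight_packing (c s : R) : 0 < c -> c < 1 -> 0 < s -> s <= 1 ->
  exists n1 : nat, forall (U : finType) (h : U -> U -> U -> bool),
    uniform_triples h -> (n1 <= #|U|)%N ->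
    ex_density (c / 3) + s <= density R h ->
  exists ps, tight_packing h ps /\ c * #|U|%:R <= (packing_edges ps)%:R.
Proof.
move=> c0 c1 s0 s1.
(* Aiming at [c / 3 + sg] leaves, after the loss [gam = sg], a surplus rate [2 * sg] that pays for
   the vertices left over at the end and for rounding. [s / 36] makes the threshold density rise by
   at most [s / 4]; [(1 - c) / 3] keeps [3 * x <= 1]. *)
pose sg := Num.min (s / 36) ((1 - c) / 3).
have sg0 : 0 < sg by rewrite lt_min !divr_gt0// subr_gt0.
have sg1 : sg <= s / 36 by rewrite ge_min lexx.
have sg2 : sg <= (1 - c) / 3 by rewrite ge_min lexx orbT.
pose x := c / 3 + sg; pose eta := sg / 2; pose e := s * eta / 96.
have eta0 : 0 < eta by rewrite divr_gt0.
have e0 : 0 < e by rewrite divr_gt0// mulr_gt0.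
have es : e <= s / 8.
  have -> : e = s / 8 * (eta / 12) by rewrite /e; field.
  by rewrite -[leRHS]mulr1 ler_wpM2l// /eta; lra.
have xd : ex_density x <= ex_density (c / 3) + 9 * sg.
  by apply: ex_density_lip; lra.
pose d0 := ex_density (c / 3) + s / 2.
have [||||||q [n0 [q0 step]]] := @blowup_step R x d0 e sg.
- by rewrite /x; lra.
- by rewrite /x; lra.
- by [].
- by lra.
- by rewrite /d0; lra.
- by [].
have qR : (0 : R) < q%:R by rewrite ltr0n.
exists (Num.truncn (n0%:R / eta + q%:R / (e * eta) + 2 * q%:R / sg)).+1.
move=> U h hU nU dU; pose n : R := #|U|%:R.
have nbig : n0%:R / eta + q%:R / (e * eta) + 2 * q%:R / sg <= n.
  apply: ltW; apply: lt_le_trans (truncnS_gt _) _; by rewrite ler_nat.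
have A0 : 0 <= n0%:R / eta by rewrite divr_ge0 ?ler0n// ltW.
have B0 : 0 < q%:R / (e * eta) by rewrite divr_gt0// mulr_gt0.
have C0 : 0 < 2 * q%:R / sg by rewrite divr_gt0// mulr_gt0.
have n_gt0 : 0 < n by lra.
have nA : n0%:R <= eta * n by rewrite mulrC -ler_pdivrMr//; lra.
have nB : q%:R <= e * (eta * n) by rewrite mulrA mulrC -ler_pdivrMr ?mulr_gt0//; lra.
have nC : 2 * q%:R <= sg * n by rewrite [leRHS]mulrC -ler_pdivrMr//; lra.
pose w0 := eta * n; have w00 : 0 < w0 by rewrite mulr_gt0.
(* The process stops with [w0 = eta * n] vertices. At most [n / q] removals lose density at most
   [48 * e / eta] altogether, which is [s / 2] by the choice of [e]. *)
pose k := 48 * q%:R * e / w0.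
have k0 : 0 < k by rewrite /k divr_gt0// mulr_gt0// mulr_gt0.
pose r := Num.truncn ((1 - eta) * n / q%:R).
have /andP[rle rgt] : r%:R <= (1 - eta) * n / q%:R < r.+1%:R.
  by apply: truncn_itv; rewrite divr_ge0 ?mulr_ge0// ?ltW// /eta; lra.
rewrite ler_pdivlMr// in rle; rewrite ltr_pdivrMr// -natr1 in rgt.
have rk : r%:R * k <= s / 2.
  have -> : r%:R * k = (r%:R * q%:R) * (48 * e / w0) by rewrite /k; ring.
  apply: (@le_trans _ _ (n * (48 * e / w0))).
    have pos : 0 < 48 * e / w0 by rewrite divr_gt0// mulr_gt0.
    rewrite ler_pM2r//; apply: le_trans rle _.
    by rewrite mulrBl mul1r lerBlDr lerDl ltW// mulr_gt0.
  rewrite le_eqVlt; apply/orP; left; apply/eqP; rewrite /w0 /e; field.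
  by rewrite !gt_eqF.
have [||||ps [tps eps]] := @iterate_step x d0 e sg w0 k q n0 (ltW e0) w00 nA _ (ltW k0) _ step r U h hU.
- apply: le_trans nB _; rewrite -/w0 -[leRHS]mul1r ler_wpM2r ?ltW//; lra.
- move=> w ww; have -> : 24 * (q%:R ^+ 2 + q%:R * e * w) = 24 * q%:R * (q%:R + e * w) by ring.
  have w_gt0 : 0 < w by apply: lt_le_trans ww.
  have ew : e * w0 <= e * w by rewrite ler_wpM2l// ltW.
  apply: (@le_trans _ _ (24 * q%:R * (2 * (e * w)))).
    have q24 : 0 < 24 * q%:R :> R by rewrite mulr_gt0.
    by rewrite ler_pM2l//; rewrite -/w0 in nB; lra.
  have -> : 24 * q%:R * (2 * (e * w)) = k * (w0 * w) by rewrite /k; field; rewrite gt_eqF.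
  by rewrite ler_pM2l// expr2 ler_pM2r.
- by rewrite -/n /w0; lra.
- by apply: le_trans dU; rewrite /d0; lra.
exists ps; split=> //; apply: le_trans eps; rewrite -/n /x.
have cs : 0 <= c + 2 * sg by lra.
have : (c + 2 * sg) * ((1 - eta) * n - q%:R) <= (c + 2 * sg) * (r%:R * q%:R).
  by rewrite ler_wpM2l//; lra.
have : (c + 2 * sg) * q%:R <= 2 * q%:R by rewrite ler_wpM2r ?ltW//; lra.
have : (c + sg) * n <= (c + 2 * sg) * (1 - eta) * n.
  by rewrite ler_wpM2r ?ltW// /eta; nra.
lra.
Qed.
End Iterate.

(** * Tight linear forests *)

Local Open Scope nat_scope.

Section ForestDegrees.
Variables (T : finType) (F : {set {set T}}).
Hypothesis forestF : tight_linear_forest F.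

Lemma mem_take3_drop (s : seq T) i x : uniq s -> x \in take 3 (drop i s) ->
  i <= index x s < i + 3.
Proof.
move=> us /(nthP x)[k]; rewrite size_take_min size_drop leq_min ltn_subRL.
move=> /andP[k3 ks].
by rewrite nth_take// nth_drop => <-; rewrite index_uniq// leq_addr ltn_add2l.
Qed.

Lemma forest_degree x : #|[set e in F | x \in e]| <= 3.
Proof.
case/andP: forestF => _ /forallP/(_ x)/=; set C := component F x.
have sub : [set e in F | x \in e] \subset [set e in induced_edges F C | x \in e].
  apply/subsetP => e; rewrite !inE => /andP[eF xe]; rewrite eF xe andbT /=.
  apply/subsetP => y ye; rewrite inE; apply: connect1.
  by apply/exists_inP; exists e => //; rewrite xe.
move=> cmp; apply: leq_trans (subset_leq_card sub) _.
case/orP: cmp => [/existsP[s /and3P[us _ /eqP ->]]|/andP[_ /eqP ->]]; last first.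
  suff -> : [set e in (set0 : {set {set T}}) | x \in e] = set0 by rewrite cards0.
  by apply/setP => e; rewrite !inE.
(* A triple through [x] starts at most two places before [x]; near the start of the path, the
   truncated subtraction merely repeats a set. *)
have sub' : [set e in tight_edges s | x \in e] \subset
    [set [set v in take 3 (drop (index x s - (k : 'I_3)) s)] | k : 'I_3].
  apply/subsetP => e; rewrite inE => /andP[/imsetP[i _ ->]]; rewrite inE => xi.
  have := mem_take3_drop us xi => /andP[ix xi3].
  have lt3 : index x s - i < 3 by lia.
  by apply/imsetP; exists (Ordinal lt3) => //=; rewrite subKn.
apply: leq_trans (subset_leq_card sub') _.
by apply: leq_trans (leq_imset_card _ _) _; rewrite card_ord.
Qed.

Lemma forest_hitting_set (P : {set T}) :
  (forall e, e \in F -> exists2 x, x \in e & x \in P) -> #|F| <= 3 * #|P|.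
Proof.
move=> hit.
have -> : 3 * #|P| = \sum_(x in P) 3 by rewrite sum_nat_const mulnC.
apply: (@leq_trans (\sum_(x in P) #|[set e in F | x \in e]|)); last first.
  by apply: leq_sum => x _; apply: forest_degree.
under eq_bigr do rewrite -sum1_card big_mkcond/=.
rewrite exchange_big/= -sum1_card big_mkcond/=; apply: leq_sum => e _.
case: ifP => // eF; have [x xe xP] := hit e eF.
by rewrite (bigD1 x)//= inE eF xe.
Qed.

Lemma forest_span : #|F| <= #|cover F|.
Proof.
rewrite -(leq_pmul2l (isT : 0 < 3)).
have -> : 3 * #|F| = \sum_(e in F) #|e|.
  rewrite mulnC -sum_nat_const; apply: eq_bigr => e eF.
  by case/andP: forestF => /forall_inP/(_ e eF)/eqP ->.
have -> : 3 * #|cover F| = \sum_(x in cover F) 3 by rewrite sum_nat_const mulnC.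
apply: (@leq_trans (\sum_(x in cover F) #|[set e in F | x \in e]|)); last first.
  by apply: leq_sum => x _; apply: forest_degree.
under eq_bigr do rewrite -sum1_card big_mkcond/=.
under [leqRHS]eq_bigr do rewrite -sum1_card big_mkcond/=.
rewrite [leqRHS]exchange_big/= big_mkcond/=; apply: leq_sum => e _.
case: ifP => // eF; rewrite [leqRHS]big_mkcond/=; apply: leq_sum => x _.
case: ifP => // xe; have -> : x \in cover F by apply/bigcupP; exists e.
by rewrite inE eF xe.
Qed.
End ForestDegrees.

(** * Extremal constructions: the clique and the star *)

Section LowerBounds.
Variables (n k a : nat).

Lemma ex3_ge_clique : a < k -> a <= n -> 'C(a, 3) <= ex3 n (TLF n k).
Proof.
move=> ak an; have [A _ cA] := @exists_subset_card 'I_n setT a (ltac:(by rewrite cardsT card_ord)).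
pose E := [set e : {set 'I_n} | e \subset A & #|e| == 3].
have cE : #|E| = 'C(a, 3) by rewrite -cA -cards_draws.
rewrite -cE; apply: leq_bigmax_cond; apply/andP; split.
  by apply/forall_inP => e; rewrite inE => /andP[].
apply/forall_inP => F; rewrite inE => /andP[tF /eqP cF].
apply/negP => /existsP[f /andP[/injectiveP inj /forall_inP fE]].
have : #|cover F| <= #|A|.
  rewrite -(card_imset _ inj); apply: subset_leq_card; apply/subsetP => y /imsetP[x].
  move=> /bigcupP[e eF xe] ->; have := fE e eF; rewrite inE => /andP[/subsetP sub _].
  by apply: sub; apply: imset_f.
by have := forest_span tF; lia.
Qed.

Lemma ex3_ge_star : 3 * a < k -> a <= n -> 'C(n, 3) - 'C(n - a, 3) <= ex3 n (TLF n k).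
Proof.
move=> ak an; have [A _ cA] := @exists_subset_card 'I_n setT a (ltac:(by rewrite cardsT card_ord)).
pose E := [set e : {set 'I_n} | #|e| == 3] :\: [set e : {set 'I_n} | e \subset ~: A & #|e| == 3].
have cE : #|E| = 'C(n, 3) - 'C(n - a, 3).
  have -> : 'C(n - a, 3) = #|[set e : {set 'I_n} | e \subset ~: A & #|e| == 3]|.
    by rewrite cards_draws cardsCs setCK cA card_ord.
  rewrite cardsDS; last by apply/subsetP => e; rewrite !inE => /andP[].
  by rewrite card_draws card_ord.
rewrite -cE; apply: leq_bigmax_cond; apply/andP; split.
  by apply/forall_inP => e; rewrite !inE => /andP[].
apply/forall_inP => F; rewrite inE => /andP[tF /eqP cF].
apply/negP => /existsP[f /andP[/injectiveP inj /forall_inP fE]].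
have : #|f @^-1: A| <= #|A|.
  rewrite -(card_imset _ inj); apply: subset_leq_card; apply/subsetP => y /imsetP[x].
  by rewrite inE => fx ->.
suff : #|F| <= 3 * #|f @^-1: A| by lia.
apply: (forest_hitting_set tF) => e eF; have := fE e eF; rewrite !inE.
move=> /andP[+ e3]; rewrite e3 andbT => /subsetPn[_ /imsetP[x xe ->]].
by rewrite inE negbK => fxA; exists x; rewrite ?inE.
Qed.
End LowerBounds.

(** * Tight linear forests from packings of tight paths *)

Section ForestOfPacking.
Variables (T : finType) (E : {set {set T}}).
Hypothesis graphE : graph3 E.

Definition edge3 (x y z : T) : bool := [set x; y; z] \in E.

Lemma tight_take3_drop (p : seq T) i : tight edge3 p -> i < size p - 2 ->
  [set v in take 3 (drop i p)] \in E.
Proof.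
elim: p i => [|x [|y [|z p]] IH] [|i] //= /andP[hx tp] ip.
  have -> : [set v in x :: y :: z :: take 0 p] = [set x; y; z] by
    rewrite take0; apply/setP => v; rewrite !inE orbA.
  exact: hx.
by apply: (IH i tp); move: ip => /=; lia.
Qed.

Lemma card_tight_edges (p : seq T) : uniq p -> #|tight_edges p| = size p - 2.
Proof.
move=> up; have key (i j : 'I_(size p - 2)) : i < j ->
    [set v in take 3 (drop i p)] <> [set v in take 3 (drop j p)].
  move=> ij /setP eq; have ip : i < size p by have := ltn_ord i; lia.
  case: p up i j ij eq ip => [|x0 p'] // up i j ij eq ip.
  set q := x0 :: p' in up i j ij eq ip *.
  have : nth x0 q i \in take 3 (drop i q) by rewrite (drop_nth x0)//= inE eqxx.
  have := eq (nth x0 q i); rewrite !inE => -> /(mem_take3_drop up).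
  by rewrite index_uniq//; lia.
rewrite card_imset ?card_ord// => i j.
by have [/key//|/key ne /esym/ne//|/val_inj->] := ltngtP i j.
Qed.

Fixpoint forest_of (ps : seq (seq T)) : {set {set T}} :=
  if ps is p :: ps' then tight_edges p :|: forest_of ps' else set0.

Lemma mem_forest_of ps e :
  reflect (exists2 p, p \in ps & e \in tight_edges p) (e \in forest_of ps).
Proof.
elim: ps => [|p ps IH] /=; first by rewrite inE; constructor => -[].
rewrite inE; apply: (iffP orP) => [[ep|/IH[q qps eq]]|[q]].
- by exists p; rewrite ?inE ?eqxx.
- by exists q; rewrite ?inE ?qps ?orbT.
- by rewrite inE => /orP[/eqP ->|qps eq]; [left|right; apply/IH; exists q].
Qed.

Lemma tight_edges_sub (p : seq T) e x : e \in tight_edges p -> x \in e -> x \in p.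
Proof. by move=> /imsetP[i _ ->]; rewrite inE => /mem_take/mem_drop. Qed.

Lemma uniq_flatten_eq (ps : seq (seq T)) p q x : uniq (flatten ps) ->
  p \in ps -> q \in ps -> x \in p -> x \in q -> p = q.
Proof.
elim: ps => //= r ps IH; rewrite cat_uniq => /and3P[_ /hasPn dis ups].
have out s : s \in ps -> x \in s -> x \notin r.
  by move=> sps xs; apply: dis; apply/flattenP; exists s.
rewrite !inE => /orP[/eqP ->|pps] /orP[/eqP ->|qps] xp xq //.
- by have := out q qps xq; rewrite xp.
- by have := out p pps xp; rewrite xq.
- exact: IH.
Qed.

Lemma uniq_flatten_mem (ps : seq (seq T)) p : uniq (flatten ps) -> p \in ps -> uniq p.
Proof.
elim: ps => //= r ps IH; rewrite cat_uniq => /and3P[ur _ ups].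
by rewrite inE => /orP[/eqP ->|/IH]; last apply.
Qed.

Section Forest.
Variable ps : seq (seq T).
Hypothesis packing : tight_packing edge3 ps.
Let F := forest_of ps.
Let ups : uniq (flatten ps). Proof. by case/andP: packing. Qed.

Lemma tight_edges_in p e : tight edge3 p -> e \in tight_edges p -> e \in E.
Proof. by move=> tp /imsetP[i _ ->]; apply: tight_take3_drop. Qed.

Lemma forest_of_sub : F \subset E.
Proof.
apply/subsetP => e /mem_forest_of[p pps]; apply: tight_edges_in.
by case/andP: packing => _ /allP; apply.
Qed.

Let card3 e : e \in F -> #|e| = 3.
Proof. by move/(subsetP forest_of_sub) => eE; apply/eqP; apply: (forall_inP graphE). Qed.

Lemma card_forest_of : #|F| = packing_edges ps.
Proof.
rewrite /F /packing_edges; elim: ps packing => [|p qs IH] pk /=.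
  by rewrite big_nil cards0.
case/andP: (pk) => /=; rewrite cat_uniq => /and3P[up dis uqs] /andP[tp tqs].
rewrite big_cons cardsU card_tight_edges// IH ?/tight_packing ?uqs//.
suff -> : tight_edges p :&: forest_of qs = set0 by rewrite cards0 subn0.
apply/setP => e; rewrite !inE.
apply/negP => /andP[ep /mem_forest_of[q qqs eq]].
have : #|e| == 3 by apply: (forall_inP graphE); apply: tight_edges_in ep.
have [->|[x xe] _] := set_0Vmem e; first by rewrite cards0.
move/hasPn: dis => /(_ x); rewrite (tight_edges_sub ep xe) => /(_ _)/negP; apply=> //.
by apply/flattenP; exists q => //; apply: tight_edges_sub xe.
Qed.

Lemma hadj_forest_of p x y : p \in ps -> x \in p -> hadj F x y -> y \in p.
Proof.
move=> pps xp /exists_inP[e /mem_forest_of[q qps eq] /andP[xe ye]].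
rewrite (uniq_flatten_eq ups pps qps xp (tight_edges_sub eq xe)).
exact: tight_edges_sub ye.
Qed.

Lemma connect_sub_path p x y : p \in ps -> x \in p -> connect (hadj F) x y -> y \in p.
Proof.
move=> pps xp /connectP[s]; elim: s x xp => [|z s IH] x xp /=; first by move=> _ ->.
by move=> /andP[xz zs] yl; apply: (IH z) => //; apply: hadj_forest_of xz.
Qed.

Lemma connect_path p x y : p \in ps -> 2 < size p -> x \in p -> y \in p ->
  connect (hadj F) x y.
Proof.
move=> pps p3 xp yp.
have sym : connect_sym (hadj F).
  by apply: sym_connect_sym => u v; apply: eq_existsb => e; rewrite [X in _ && X]andbC.
have up := uniq_flatten_mem ups pps.
have step i : i.+1 < size p -> hadj F (nth x p i) (nth x p i.+1).
  move=> ip.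
  (* The window starting at [i] is moved back at the end of the path, so that the last two vertices
     also lie in a full triple. *)
  pose j := minn i (size p - 3).
  have jp : j < size p - 2 by rewrite /j; lia.
  apply/exists_inP; exists [set v in take 3 (drop j p)].
    by apply/mem_forest_of; exists p => //; apply/imsetP; exists (Ordinal jp).
  have mem k : j <= k -> k < j + 3 -> k < size p -> nth x p k \in take 3 (drop j p).
    move=> jk kj kp; rewrite -(subnKC jk) -nth_drop -(@nth_take 3); last by lia.
    by apply: mem_nth; rewrite size_take_min size_drop; lia.
  by rewrite !inE !mem //; rewrite /j; lia.
have conn0 i : i < size p -> connect (hadj F) (nth x p 0) (nth x p i).
  elim: i => // i IH ip; apply: connect_trans (IH (ltnW ip)) _.
  by apply: connect1; apply: step.
rewrite -(nth_index x xp) -(nth_index x yp).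
by apply: connect_trans (conn0 _ _); rewrite ?index_mem// sym conn0// index_mem.
Qed.

Lemma forest_of_packing : tight_linear_forest F.
Proof.
apply/andP; split; first by apply/forall_inP => e /card3 ->.
apply/forallP => x; apply/orP.
(* Sequences of length at most 2 carry no edge: their vertices are isolated, like those outside the
   packing. *)
have [/hasP[p pps /andP[p3 xp]]|none] := boolP (has (fun p => (2 < size p) && (x \in p)) ps).
  left; have up := uniq_flatten_mem ups pps.
  have CE : component F x = [set v in p].
    apply/setP => y; rewrite !inE; apply/idP/idP; first exact: connect_sub_path.
    exact: connect_path.
  rewrite /= CE; have sz : size p == #|[set v in p]| by rewrite cardsE; apply/eqP/esym/card_uniqP.
  apply/existsP; exists (Tuple sz); rewrite /= up eqxx /=.
  apply/eqP/setP => e; rewrite inE; apply/idP/idP; last first.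
    move=> ep; apply/andP; split; first by apply/mem_forest_of; exists p.
    by apply/subsetP => y ye; rewrite inE; apply: tight_edges_sub ye.
  move=> /andP[eF /subsetP sub]; have c3 := card3 eF.
  have [e0|[y ye]] := set_0Vmem e; first by rewrite e0 cards0 in c3.
  have := sub y ye; rewrite inE => yp; move/mem_forest_of: eF => [q qps eq].
  by rewrite (uniq_flatten_eq ups pps qps yp (tight_edges_sub eq ye)).
right; have lone e : e \in F -> x \notin e.
  move=> /mem_forest_of[p pps ep]; apply/negP => xe.
  move/hasPn: none => /(_ p pps); rewrite (tight_edges_sub ep xe) andbT -leqNgt => p2.
  case/imsetP: ep => -[i ip] _ _; move: (leq_ltn_trans (leq0n i) ip).
  by rewrite subn_gt0 ltnNge p2.
have CE : component F x = [set x].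
  apply/setP => y; rewrite !inE; apply/idP/eqP => [/connectP[[|z s] /=]|->]; last exact: connect0.
    by move=> _ ->.
  by move=> /andP[/exists_inP[e /lone/negP xe /andP[]]].
rewrite /isolated_vertex CE cards1 eqxx /=; apply/eqP/setP => e; rewrite !inE.
apply/negP => /andP[eF /subset_leq_card]; rewrite cards1 card3//.
Qed.
End Forest.

(** The forbidden family asks for exactly [k] edges. Paths are dropped while the others suffice, and
    then one is cut to a prefix, of [j + 2] vertices for [j] edges. *)
Lemma trim_packing ps k : tight_packing edge3 ps -> k <= packing_edges ps ->
  exists2 qs, tight_packing edge3 qs & packing_edges qs = k.
Proof.
elim: ps => [|p ps IH] pk; rewrite /packing_edges ?big_nil ?big_cons => kp.
  by exists [::]; rewrite ?/packing_edges ?big_nil//; lia.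
case/andP: (pk) => /=; rewrite cat_uniq => /and3P[up dis ups] /andP[tp tps].
have [le|gt] := leqP k (packing_edges ps).
  by apply: IH; rewrite ?/tight_packing ?ups.
exists (take (k - packing_edges ps).+2 p :: ps).
  apply/andP; rewrite /= tps andbT cat_uniq take_uniq// ups andbT; split.
    by apply: contra dis => /hasP[x xps /mem_take xp]; apply/hasP; exists x.
  elim: p (_.+2) tp {up dis pk kp} => [|x q IHq] [|m] //= /andP[hx tq].
  rewrite IHq ?andbT//; case: q m hx {IHq tq} => [|y [|z q]] [|[|m]] //=.
rewrite /packing_edges big_cons -/(packing_edges ps) size_take_min.
rewrite /packing_edges in kp gt *; lia.
Qed.
End ForestOfPacking.

Lemma packing_bound n k (E : {set {set 'I_n}}) ps :
  graph3 E -> [forall F in TLF n k, ~~ contains_copy F E] ->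
  tight_packing (edge3 E) ps -> packing_edges ps < k.
Proof.
move=> gE /forall_inP noF pk; rewrite ltnNge; apply/negP => /(trim_packing gE pk)[qs qk eqs].
have : ~~ contains_copy (forest_of qs) E.
  by apply: noF; rewrite inE (forest_of_packing gE qk) (card_forest_of gE qk) eqs eqxx.
move/negP; apply; apply/existsP; exists [ffun x => x]; apply/andP; split.
  by apply/injectiveP => x y; rewrite !ffunE.
apply/forall_inP => e eF; suff -> : [ffun x : 'I_n => x] @: e = e.
  by apply: (subsetP (forest_of_sub _ qk)).

by rewrite (eq_imset (g := id)) ?imset_id// => x; rewrite ffunE.
Qed.

Local Open Scope ring_scope.

(** * Asymptotics *)

Section TripleSystems.
Variables (T : finType) (E : {set {set T}}).
Hypothesis graphE : graph3 E.

Lemma uniform_edge3 : uniform_triples (edge3 E).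
Proof.
split=> [x y z|x y z|x y z]; rewrite /edge3.
- by rewrite [[set x; y]]setUC.
- by rewrite setUAC.
move=> /(forall_inP graphE); rewrite setUC cardsU1 cards2 !inE negb_or.
rewrite [z == x]eq_sym [z == y]eq_sym.
by case: (x != y); case: (x != z); case: (y != z).
Qed.

Lemma triples_edge3 (R : realFieldType) : 6 * #|E|%:R <= triples R (edge3 E).
Proof.
have -> : triples R (edge3 E) =
    \sum_(e in E) \sum_(q : T * T * T) ([set q.1.1; q.1.2; q.2] == e)%:R.
  rewrite /triples [LHS]pair_big [LHS]pair_big [RHS]exchange_big/=; apply: eq_bigr => q _.
  rewrite /edge3; have [qE|qE] := boolP ([set q.1.1; q.1.2; q.2] \in E).
    rewrite (bigD1 _ qE)/= eqxx big1 ?addr0// => e /andP[_ /negPf].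
    by rewrite eq_sym => ->.
  by rewrite big1// => e eE; case: eqP => // qe; rewrite qe eE in qE.
rewrite mulr_natr -sumr_const; apply: ler_sum => e eE.
have /eqP c3 := forall_inP graphE e eE.
have [x [y [z [[xe ye ze] [xy yz zx]]]]] : exists x y z,
    [/\ x \in e, y \in e & z \in e] /\ [/\ x != y, y != z & z != x].
  by apply/card_gt2P; rewrite c3.
have eE' : e = [set x; y; z].
  have c3' : #|[set x; y; z]| = 3.
    by rewrite setUC cardsU1 cards2 !inE negb_or xy zx [z == y]eq_sym yz.
  apply/esym/eqP; rewrite eqEcard c3 c3' andbT; apply/subsetP => v.
  by rewrite !inE => /orP[/orP[]|] /eqP ->.
pose s : seq (T * T * T) := [:: (x, y, z); (x, z, y); (y, x, z); (y, z, x); (z, x, y); (z, y, x)].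
have us : uniq s.
  have [yx zy xz] : [/\ y != x, z != y & x != z] by rewrite eq_sym xy eq_sym yz eq_sym zx.
  by rewrite /= !inE !xpair_eqE (negPf xy) (negPf yx) (negPf yz) (negPf zy) (negPf zx)
    (negPf xz) !eqxx.
have -> : 6 = \sum_(q in s) 1 :> R.
  by rewrite sumr_const (card_uniqP us).
rewrite big_mkcond/=; apply: ler_sum => q _; case: ifP => [|_]; last exact: ler0n.
have P (a b c : T) : [set a; b; c] = e -> 1 <= ([set a; b; c] == e)%:R :> R.
  by move=> ->; rewrite eqxx.
rewrite !inE => /or4P[|||/or3P[]] /eqP -> /=; apply: P; rewrite eE';
  by apply/setP => v; rewrite !inE; case: (v == x); case: (v == y); case: (v == z).
Qed.
End TripleSystems.

Section Binomials.
Variable R : archiRealFieldType.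

Lemma bin3R (m : nat) : 6 * 'C(m, 3)%:R = m%:R * (m%:R - 1) * (m%:R - 2) :> R.
Proof.
have bin2R l : 2 * 'C(l, 2)%:R = l%:R * (l%:R - 1) :> R.
  elim: l => [|l IH]; first by rewrite bin0n mulr0 mul0r.
  by rewrite binS natrD mulrDr IH bin1 -natr1; ring.
elim: m => [|m IH]; first by rewrite bin0n mulr0 !mul0r.
by rewrite binS natrD mulrDr IH -natr1; have := bin2R m; lra.
Qed.

Lemma bin3_le (m : nat) : 6 * 'C(m, 3)%:R <= m%:R ^+ 3 :> R.
Proof.
rewrite bin3R; have [->|m0] := posnP m; first by rewrite !mul0r expr0n.
have : 1 <= m%:R :> R by rewrite ler1n.
nra.
Qed.

Lemma bin3_ge (m : nat) (n : R) : m%:R <= n -> m%:R ^+ 3 - 3 * n ^+ 2 <= 6 * 'C(m, 3)%:R.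
Proof.
move=> mn; have m0 : 0 <= m%:R :> R by apply: ler0n.
rewrite bin3R; have : m%:R ^+ 2 <= n ^+ 2 by rewrite lerXn2r// nnegrE (le_trans m0).
lra.
Qed.

Lemma cube_sub_le (x y n : R) : 0 <= x -> x <= n -> 0 <= y -> y <= n -> x <= y + 1 ->
  x ^+ 3 <= y ^+ 3 + 3 * n ^+ 2.
Proof.
move=> x0 xn y0 yn xy; have n0 : 0 <= n by apply: le_trans xn.
have [xley|yltx] := leP x y.
  apply: (@le_trans _ _ (y ^+ 3)); first by rewrite lerXn2r// nnegrE.
  by rewrite lerDl mulr_ge0// sqr_ge0.
have s0 : x ^+ 2 + x * y + y ^+ 2 <= 3 * n ^+ 2 by nra.
have s1 : 0 <= x ^+ 2 + x * y + y ^+ 2 by rewrite !addr_ge0// ?mulr_ge0// sqr_ge0.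
have : (x - y) * (x ^+ 2 + x * y + y ^+ 2) <= 1 * (x ^+ 2 + x * y + y ^+ 2).
  by rewrite ler_wpM2r//; lra.
lra.
Qed.
End Binomials.

Section Asymptotics.
Variables (R : archiRealFieldType) (c : R).
Hypotheses (c_gt0 : 0 < c) (c_lt1 : c < 1).

Definition clique_or_star (n : nat) : R :=
  Num.max ('C(Num.truncn (c * n%:R), 3)%:R : R)
    ('C(n, 3)%:R - 'C(n - Num.truncn (c * n%:R / 3), 3)%:R).

Let k (n : nat) := Num.truncn (c * n%:R).
Let b (n : nat) := Num.truncn (c * n%:R / 3).

Let kP (n : nat) : (k n)%:R <= c * n%:R < (k n)%:R + 1.
Proof. by rewrite natr1; apply: truncn_itv; rewrite mulr_ge0 ?ler0n// ltW. Qed.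

Let bP (n : nat) : (b n)%:R <= c * n%:R / 3 < (b n)%:R + 1.
Proof. by rewrite natr1; apply: truncn_itv; rewrite divr_ge0// mulr_ge0 ?ler0n// ltW. Qed.

Let cn_le (n : nat) : c * n%:R <= n%:R.
Proof. by rewrite -[leRHS]mul1r ler_wpM2r ?ler0n// ltW. Qed.

Let k_le (n : nat) : (k n <= n)%N.
Proof. by rewrite -(ler_nat R); have /andP[h _] := kP n; apply: le_trans h (cn_le n). Qed.

Let b_le (n : nat) : (3 * b n <= k n)%N.
Proof.
rewrite /k truncn_ge_nat; last by rewrite mulr_ge0 ?ler0n// ltW.
rewrite natrM.
by have /andP[h _] := bP n; lra.
Qed.

(** [forest_span] and [forest_hitting_set] exclude [k] edges only strictly below [k] vertices,
    respectively [k / 3] centres. Both constructions are therefore taken one vertex smaller, at a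
    cost of at most [n ^ 2] edges. *)
Lemma clique_or_star_le (n : nat) : 3 <= c * n%:R ->
  clique_or_star n <= (ex3 n (TLF n (k n)))%:R + n%:R ^+ 2.
Proof.
move=> cn3; have /andP[k1 k2] := kP n; have /andP[b1 b2] := bP n.
have n0 : 0 <= n%:R :> R by apply: ler0n.
have k_gt0 : (0 < k n)%N by rewrite truncn_gt0; lra.
have b_gt0 : (0 < b n)%N by rewrite truncn_gt0; lra.
have kn := k_le n; have bk := b_le n; rewrite /clique_or_star ge_max -/(k n) -/(b n).
have knR : (k n)%:R <= n%:R :> R by rewrite ler_nat.
apply/andP; split.
  have : 'C((k n).-1, 3)%:R <= (ex3 n (TLF n (k n)))%:R :> R.
    by rewrite ler_nat; apply: ex3_ge_clique; rewrite ?prednK// (leq_trans (leq_pred _)).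
  have pk : (k n)%:R = (k n).-1%:R + 1 :> R by rewrite natr1 prednK.
  have p0 : 0 <= (k n).-1%:R :> R by apply: ler0n.
  have l1 : (k n).-1%:R <= n%:R :> R by lra.
  have := bin3_ge l1; have := bin3_le R (k n).
  have := @cube_sub_le R (k n)%:R (k n).-1%:R n%:R (ler0n _ _) knR p0 l1.
  move=> cube ? ?; have : (k n)%:R ^+ 3 <= (k n).-1%:R ^+ 3 + 3 * n%:R ^+ 2 :> R.
    by apply: cube; rewrite pk.
  lra.
have [ab bn] : (3 * (b n).-1 < k n)%N /\ (b n <= n)%N.
  by move: kn bk b_gt0; move: (k n) (b n) => K [|B]; clear; lia.
have ab' := leq_trans (leq_pred _) bn.
have : ('C(n, 3) - 'C(n - (b n).-1, 3))%:R <= (ex3 n (TLF n (k n)))%:R :> R.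
  by rewrite ler_nat; apply: ex3_ge_star.
rewrite natrB; last by apply: leq_bin2l; apply: leq_subr.
have pb : (n - (b n).-1)%:R = (n - b n)%:R + 1 :> R.
  by rewrite natr1; congr (_%:R); move: bn b_gt0; move: (b n) => [|B]; clear; lia.
have l1 : (n - (b n).-1)%:R <= n%:R :> R by rewrite ler_nat leq_subr.
have l2 : (n - b n)%:R <= n%:R :> R by rewrite ler_nat leq_subr.
have := bin3_ge l2; have := bin3_le R (n - (b n).-1).
have := @cube_sub_le R _ _ n%:R (ler0n _ (n - (b n).-1)%N) l1 (ler0n _ (n - b n)%N) l2.
move=> cube ? ?; have : (n - (b n).-1)%:R ^+ 3 <= (n - b n)%:R ^+ 3 + 3 * n%:R ^+ 2 :> R.
  by apply: cube; rewrite pb.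
lra.
Qed.

Lemma ex_density_le_clique_or_star (n : nat) :
  ex_density (c / 3) * n%:R ^+ 3 <= 6 * clique_or_star n + 6 * n%:R ^+ 2.
Proof.
have /andP[k1 k2] := kP n; have /andP[b1 b2] := bP n.
have n0 : 0 <= n%:R :> R by apply: ler0n.
have kn := k_le n; have bk := b_le n.
have cn := cn_le n; have cn0 : 0 <= c * n%:R by rewrite mulr_ge0// ltW.
rewrite /ex_density maxr_pMl ?exprn_ge0// ge_max; apply/andP; split.
  have : 'C(k n, 3)%:R <= clique_or_star n by rewrite /clique_or_star le_max lexx.
  have knR : (k n)%:R <= n%:R :> R by rewrite ler_nat.
  have := bin3_ge knR.
  have := @cube_sub_le R (c * n%:R) (k n)%:R n%:R cn0 cn (ler0n _ _) knR (ltW k2).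
  have -> : 27 * (c / 3) ^+ 3 * n%:R ^+ 3 = (c * n%:R) ^+ 3 by field.
  lra.
have : 'C(n, 3)%:R - 'C(n - b n, 3)%:R <= clique_or_star n.
  by rewrite /clique_or_star le_max lexx orbT.
have := @bin3_ge R n n%:R (lexx _); have := bin3_le R (n - b n).
have bE : (n - b n)%:R = n%:R - (b n)%:R :> R by rewrite natrB//; lia.
have := @cube_sub_le R (n - b n)%:R (n%:R - c * n%:R / 3) n%:R (ler0n _ _).
rewrite bE; have -> : (1 - (1 - c / 3) ^+ 3) * n%:R ^+ 3 =
  n%:R ^+ 3 - (n%:R - c * n%:R / 3) ^+ 3 by ring.
have b0 : 0 <= (b n)%:R :> R by apply: ler0n.
move=> H ? ? ?; have : (n%:R - (b n)%:R) ^+ 3 <= (n%:R - c * n%:R / 3) ^+ 3 + 3 * n%:R ^+ 2.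
  by apply: H; lra.
lra.
Qed.

Lemma ex3_le_clique_or_star (eps : R) : 0 < eps -> eps <= 1 ->
  exists n1 : nat, forall n : nat, (n1 <= n)%N ->
    (ex3 n (TLF n (k n)))%:R <= clique_or_star n + eps * n%:R ^+ 3.
Proof.
move=> eps0 eps1.
have [n1 H] := dense_tight_packing c_gt0 c_lt1 eps0 eps1.
exists (maxn n1 (Num.truncn (2 / eps)).+1) => n; rewrite geq_max => /andP[n1n n2n].
have n_big : 2 / eps <= n%:R.
  by apply: ltW; apply: lt_le_trans (truncnS_gt _) _; rewrite ler_nat.
rewrite ler_pdivrMr// in n_big.
have n0 : (0 < n)%N by apply: leq_trans n2n.
have nR : 0 < n%:R :> R by rewrite ltr0n.
have rhs0 : 0 <= clique_or_star n + eps * n%:R ^+ 3.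
  apply: addr_ge0; last by apply: mulr_ge0; [apply: ltW | rewrite exprn_ge0].
  by rewrite /clique_or_star le_max ler0n.
rewrite /ex3; apply: (big_ind (fun m : nat => m%:R <= clique_or_star n + eps * n%:R ^+ 3)) => //.
  by move=> x y hx hy; rewrite /maxn; case: ifP.
move=> E /andP[gE noE]; rewrite leNgt; apply/negP => big.
have hE := uniform_edge3 gE.
have [||ps [tps eps_]] := H _ _ hE.
- by rewrite card_ord.
- rewrite /density card_ord ler_pdivlMr ?exprn_gt0//.
  apply: le_trans (triples_edge3 gE R).
  (* Six times the assumed excess [eps * n ^ 3] covers the excess density [eps] and the error
     [6 * n ^ 2], which is at most [3 * eps * n ^ 3]. *)
  have := ex_density_le_clique_or_star n.
  have : 2 * n%:R ^+ 2 <= eps * n%:R ^+ 3.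
    have -> : eps * n%:R ^+ 3 = (n%:R * eps) * n%:R ^+ 2 by ring.
    by rewrite ler_pM2r// exprn_gt0.
  have : 0 <= eps * n%:R ^+ 3 by rewrite mulr_ge0 ?exprn_ge0// ltW.
  lra.
rewrite card_ord in eps_; have := packing_bound gE noE tps.
rewrite ltnNge => /negP; apply; rewrite -(ler_nat R).
by have /andP[k1 _] := kP n; apply: le_trans eps_.
Qed.

Lemma ex3_asymptotics (eps : R) : 0 < eps ->
  exists n1 : nat, forall n : nat, (n1 <= n)%N ->
    `|(ex3 n (TLF n (k n)))%:R - clique_or_star n| <= eps * n%:R ^+ 3.
Proof.
move=> eps0; pose e := Num.min eps 1.
have e0 : 0 < e by rewrite lt_min eps0 ltr01.
have e1 : e <= 1 by rewrite ge_min lexx orbT.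
have e_eps : e <= eps by rewrite ge_min lexx.
have [n1 H] := ex3_le_clique_or_star e0 e1.
exists (maxn n1 (maxn (Num.truncn (3 / c)).+1 (Num.truncn (eps^-1)).+1)) => n.
rewrite !geq_max => /and3P[n1n n2n n3n].
have n2 : 3 / c <= n%:R.
  by apply: ltW; apply: lt_le_trans (truncnS_gt _) _; rewrite ler_nat.
have n3 : eps^-1 <= n%:R.
  by apply: ltW; apply: lt_le_trans (truncnS_gt _) _; rewrite ler_nat.
rewrite ler_pdivrMr// mulrC in n2; rewrite -[eps^-1]mul1r ler_pdivrMr// in n3.
have hi := H n n1n; have lo := clique_or_star_le n2.
have n30 : 0 <= n%:R ^+ 3 :> R by rewrite exprn_ge0.
have : e * n%:R ^+ 3 <= eps * n%:R ^+ 3 by rewrite ler_wpM2r.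
have : n%:R ^+ 2 <= eps * n%:R ^+ 3.
  have -> : eps * n%:R ^+ 3 = (n%:R * eps) * n%:R ^+ 2 by ring.
  by rewrite -[leLHS]mul1r ler_wpM2r// sqr_ge0.
by move=> *; rewrite ler_norml; apply/andP; split; lra.
Qed.
End Asymptotics.

Unset Implicit Arguments.
From mathcomp Require Import all_classical all_reals all_analysis.
Import numFieldNormedType.Exports.
Local Open Scope classical_set_scope.
Local Open Scope ring_scope.

Theorem theorem5p2 (R : realType) (c : R) (c_gt0 : 0 < c) (c_lt1 : c < 1) :
  (fun n : nat => (ex3 n (TLF n (Num.truncn (c * n%:R))))%:R : R^o) =
  (fun n : nat =>
     Num.max ('C(Num.truncn (c * n%:R), 3)%:R : R)
       ('C(n, 3)%:R - 'C(n - Num.truncn (c * n%:R / 3%:R), 3)%:R) : R^o)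
  +o_\oo (fun n : nat => n%:R ^+ 3 : R^o).
Proof.
apply/eqaddoP => eps eps_gt0.
have [n1 H] := @ex3_asymptotics R c c_gt0 c_lt1 eps eps_gt0.
near=> n; rewrite [X in _ <= _ * X]ger0_norm ?exprn_ge0//.
by apply: H; near: n; exact: nbhs_infty_ge.
Unshelve. all: by end_near.
Qed.
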